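(* Let $G$ be a profinite group. The functor $\mathcal{AP}_G$ is equivalent (i.e. naturally isomorphic) to the functor $\Delta_G$. Hence it is equivalent to the functor $W_G$. (All are functors from the category of commutative rings with identity to itself.)
   Context: Conventions. All rings are commutative, associative, with $1\neq 0$. $G$ is a profinite group; $U,V,W$ denote open subgroups; $\mathcal O(G)$ is the set of open subgroups of $G$. $U\lesssim V$ means that $U$ is contained in a $G$-conjugate of $V$, and then $(V:U)$ denotes the index of $U$ in such a conjugate. $\varphi_U(G/V)$ is the number of $U$-fixed points of the $G$-space of left cosets $G/V$. A prime on $\sum$ or $\prod$ means that exactly one open subgroup from each $G$-conjugacy class is taken; elements of $\prod'_{U\leqslant G}R$ are written $(x_U)'_{U}$. $Z(g,V,W):=V\cap gWg^{-1}$. The same notation is used for an open subgroup $U$ of $G$ regarded as a profinite group (with $U$-conjugacy classes). The functor $W_G$ (Dress-Siebeneicher). $W_G$ is the unique functor from commutative rings to commutative rings such that: as a set $W_G(A)$ is the set of maps $\mathcal O(G)\to A$ constant on conjugacy classes; $W_G(h)(\alpha)=h\circ\alpha$ for every ring homomorphism $h:A\to B$; and for every open $U$ the map $W_G(A)\to A$, $\alpha\mapsto\sum'_{U\lesssim V\leqslant G}\varphi_U(G/V)\,\alpha(V)^{(V:U)}$, is a ring homomorphism, natural in $A$. For an ideal $I$ of $A$, $W_G(I)$ denotes the set of $\alpha\in W_G(A)$ with all values in $I$. The functor $\Delta_G$ and maps $\tau_R^G:W_G(R)\to\Delta_G(R)$. Case 1: $R\supseteq\mathbb Q$. $\Delta_G(R)$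 is the set $\prod'_{U\leqslant G}R$ with componentwise addition and multiplication $(\mathbf x\mathbf y)_U=\sum'_{V,W}p_V^W(U)x_Vy_W$, where $p_V^W(U)$ is the number of double cosets $VgW\subseteq G$ such that $Z(g,V,W)$ is conjugate to $U$ in $G$. For $r\in R$ let $(M_G(r,U))'_U$ be the unique family in $R$ with $\sum'_{U\lesssim V\leqslant G}\varphi_U(G/V)M_G(r,V)=r^{(G:U)}$ for all open $U$, and put $\tau^G(R)(r)=(M_G(r,U))'_U$ (and likewise $\tau^U(R):R\to\Delta_U(R)$). $\mathrm{Ind}_U^G(R):\Delta_U(R)\to\Delta_G(R)$ sends $(x_V)'_{V\leqslant U}$ to $(y_W)'_{W\leqslant G}$, where $y_W$ is the sum of those $x_V$ (one $V$ per $U$-conjugacy class) with $V$ conjugate to $W$ in $G$. Then $\tau_R^G(\alpha)=\sum'_{U\leqslant G}\mathrm{Ind}_U^G(R)(\tau^U(R)(\alpha(U)))$. Case 2: $R$ torsion-free, not containing $\mathbb Q$. With $R\mathbb Q=R\otimes_{\mathbb Z}\mathbb Q$, $\Delta_G(R):=\tau^G_{R\mathbb Q}(W_G(R))\subset\Delta_G(R\mathbb Q)$, and $\tau_R^G$ is the restriction of $\tau^G_{R\mathbb Q}$. Case 3: $R$ not torsion-free. Choose a surjective ring homomorphism $\rho:R'\to R$ with $R'$ torsion-free (e.g. $R'=\mathbb Z[R]$, the ring with $\mathbb Z$-basis $e_r$, $r\in R$, $e_re_s=e_{rs}$, $\rho(\sum n_re_r)=\sum n_r r$). Put $\Delta_G(\ker\rho):=\tau_{R'}^G(W_G(\ker\rho))$,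 $\Delta_G(R):=\Delta_G(R')/\Delta_G(\ker\rho)$, and let $\tau_R^G$ be induced by $\tau_{R'}^G$ on $W_G(R)=W_G(R')/W_G(\ker\rho)$. For a ring homomorphism $f:A\to B$, $\Delta_G(f)$ sends $\tau_A^G(\mathbf x)$ to $\tau_B^G(W_G(f)(\mathbf x))$, $\mathbf x\in W_G(A)$. The functor $\mathcal{AP}_G$ and maps $\theta_R^G:\Delta_G(R)\to\mathcal{AP}_G(R)$. Case 1: $R\supseteq\mathbb Q$. $\mathcal{AP}_G(R)$ is the set $\prod'_{U\leqslant G}R$ with componentwise addition and multiplication $$(\mathbf x\mathbf y)_U=\sum_{V,W\leqslant G}{}^{\!\!\!\prime}\ \sum_{g}c_V^W(g)\,x_Vy_W,\qquad c_V^W(g)=\frac{(G:Z(g,V,W))}{(G:V)(G:W)},$$ where $g$ runs over representatives of the double cosets $VgW\subseteq G$ with $Z(g,V,W)$ conjugate to $U$ in $G$. $\theta_R^G((x_U)'_U)=((G:U)x_U)'_U$. Case 2: $R$ torsion-free, not containing $\mathbb Q$. $\mathcal{AP}_G(R):=\theta^G_{R\mathbb Q}(\tau^G_{R\mathbb Q}(W_G(R)))\subset\mathcal{AP}_G(R\mathbb Q)$, and $\theta_R^G$ is the restriction of $\theta_{R\mathbb Q}^G$. Case 3: $R$ not torsion-free. With $\rho:R'\to R$ the surjective ring homomorphism from a torsion-free ring $R'$ chosen to define $\Delta_G(R)=\Delta_G(R')/\Delta_G(\ker\rho)$, where $\Delta_G(\ker\rho)=\tau_{R'}^G(W_G(\ker\rho))$,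 one puts $\mathcal{AP}_G(\ker\rho):=\theta_{R'}^G(\Delta_G(\ker\rho))$, $\mathcal{AP}_G(R):=\mathcal{AP}_G(R')/\mathcal{AP}_G(\ker\rho)$, and $\theta_R^G$ is induced by $\theta_{R'}^G$. For a ring homomorphism $f:A\to B$, $\mathcal{AP}_G(f)$ sends $\theta_A^G(\tau_A^G(\mathbf x))$ to $\theta_B^G(\tau_B^G(W_G(f)(\mathbf x)))$, $\mathbf x\in W_G(A)$. *)

(* Defs.v *)
From HB Require Import structures.
From mathcomp Require Import all_boot all_order all_algebra finmap.
From mathcomp Require Import boolp classical_sets functions cardinality fsbigop.
From mathcomp Require Import topology.
From mathcomp Require Import ring.

Set Implicit Arguments.
Unset Strict Implicit.
Unset Printing Implicit Defensive.
Import GRing.Theory.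
Local Open Scope classical_set_scope.
Local Open Scope ring_scope.

HB.mixin Record isProfiniteGroup G of Topological G & Group G := {
  profinite_mul_continuous : continuous (fun x : G * G => (x.1 * x.2)%g);
  profinite_inv_continuous : continuous (fun x : G => (x^-1)%g);
  profinite_compact : compact [set: G];
  profinite_hausdorff : hausdorff_space G;
  profinite_totally_disconnected : totally_disconnected [set: G]
}.

#[short(type="profiniteGroupType")]
HB.structure Definition ProfiniteGroup :=
  {G of Topological G & Group G & isProfiniteGroup G}.

(* The number of elements of a finite set (0 if the set is infinite). *)
Definition ncard (T : choiceType) (A : set T) : nat := #|` fset_set A|%fset.

Section Subgroups.
Variable G : profiniteGroupType.
Implicit Types (A B H V W U D : set G) (g : G).

Definition is_subgroup A : Prop :=
  [/\ A 1%g, forall x y, A x -> A y -> A (x * y)%g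
    & forall x, A x -> A (x^-1)%g].

Definition conjset g B : set G := [set (g * x * g^-1)%g | x in B].

Definition conjugate H A B : Prop := exists2 g, H g & A = conjset g B.
Definition subconj H A B : Prop := exists2 g, H g & A `<=` conjset g B.

(* The set H/V of left cosets, and the index (H:V) for V <= H. *)
Definition lcosets H V : set (set G) := [set [set (a * v)%g | v in V] | a in H].
Definition gindex H V : nat := ncard (lcosets H V).

(* (V:U), where U is contained in an H-conjugate of V: the index of U in
   such a conjugate. *)
Definition subconj_index H V U : nat :=
  gindex (xget setT [set V' | conjugate H V' V /\ U `<=` V']) U.

(* phi_U(H/V) *)
Definition mark H U V : nat :=
  ncard [set C | lcosets H V C
               /\ forall u, U u -> [set (u * c)%g | c in C] = C].

Definition Zint g V W : set G := V `&` conjset g W.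

Definition dcoset V g W : set G :=
  [set x | exists v w, [/\ V v, W w & x = (v * g * w)%g]].

(* The double cosets V g W of G such that Z(g,V,W) is conjugate to U in G;
   this condition does not depend on the representative g. *)
Definition dcosets V W U : set (set G) :=
  [set D | exists g, D = dcoset V g W /\ conjugate setT (Zint g V W) U].

(* p_V^W(U) *)
Definition dcoset_count V W U : nat := ncard (dcosets V W U).

(* c_V^W(g) *)
Definition dcoset_coef V W g : rat :=
  (gindex setT (Zint g V W))%:R / ((gindex setT V)%:R * (gindex setT W)%:R).

End Subgroups.

(* An open subgroup H of G, regarded as a profinite group, has as its open
   subgroups the open subgroups of G contained in H.  All notions for the
   profinite group H are thus expressed inside G; H = [set: G] gives G. *)
Record opensub (G : profiniteGroupType) (H : set G) := OpenSub {
  opensub_set :> set G;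
  opensub_open : open opensub_set;
  opensub_subgroup : is_subgroup opensub_set;
  opensub_sub : opensub_set `<=` H
}.

HB.instance Definition _ G H := gen_eqMixin (@opensub G H).
HB.instance Definition _ G H := gen_choiceMixin (@opensub G H).

Section Classes.
Variables (G : profiniteGroupType) (H : set G).

Definition class_repr (U : opensub H) : opensub H :=
  xget U [set V | conjugate H V U].

(* One open subgroup from each H-conjugacy class: the index set of the primed
   sums and products. *)
Record ccl := Ccl {
  ccl_val :> opensub H;
  ccl_repr : class_repr ccl_val = ccl_val
}.

End Classes.

HB.instance Definition _ G H := gen_eqMixin (@ccl G H).
HB.instance Definition _ G H := gen_choiceMixin (@ccl G H).

Record classmap (G : profiniteGroupType) (A : Type) := ClassMap {
  classmap_fun :> opensub [set: G] -> A;
  classmapP : forall U V : opensub [set: G],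
    conjugate setT U V -> classmap_fun U = classmap_fun V
}.

HB.instance Definition _ G A := gen_eqMixin (classmap G A).
HB.instance Definition _ G A := gen_choiceMixin (classmap G A).

Definition const_classmap G A (a : A) : classmap G A :=
  @ClassMap G A (fun=> a) (fun _ _ _ => erefl).

Lemma comp_classmap_subproof G A B (h : A -> B) (x : classmap G A)
    (U V : opensub [set: G]) : conjugate setT U V -> h (x U) = h (x V).
Proof. by move=> /(classmapP x) ->. Qed.

Definition comp_classmap G A B (h : A -> B) (x : classmap G A) : classmap G B :=
  ClassMap (@comp_classmap_subproof G A B h x).

(* A subset of a type with two operations.  Zero, one and opposite are
   determined by the operations when these make the subset a ring. *)
Record preRing := PreRing {
  pr_type :> Type;
  pr_dom : set pr_type;
  pr_add : pr_type -> pr_type -> pr_type;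
  pr_mul : pr_type -> pr_type -> pr_type
}.

(* The subset is closed under the operations, and is a commutative ring with
   1 != 0 for them. *)
Definition is_comring (X : preRing) : Prop :=
  exists (R : comNzRingType) (e : R -> X),
    [/\ injective e, range e = @pr_dom X,
        {morph e : a b / a + b >-> pr_add a b}
      & {morph e : a b / a * b >-> pr_mul a b}].

Definition is_one (X : preRing) (e : X) : Prop :=
  pr_dom e /\ forall x, pr_dom x -> pr_mul e x = x.

Definition is_ringhom (X Y : preRing) (f : X -> Y) : Prop :=
  [/\ forall x, pr_dom x -> pr_dom (f x),
      forall x y, pr_dom x -> pr_dom y -> f (pr_add x y) = pr_add (f x) (f y),
      forall x y, pr_dom x -> pr_dom y -> f (pr_mul x y) = pr_mul (f x) (f y)
    & forall e, is_one e -> is_one (f e)].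

Definition preRing_of (R : comNzRingType) : preRing :=
  @PreRing R [set: R] +%R *%R.

Definition sub_ring (X : preRing) (S : set X) : preRing :=
  @PreRing X S (@pr_add X) (@pr_mul X).

Definition coset_of (X : preRing) (I : set X) (x : X) : set X :=
  [set pr_add x i | i in I].

(* X/I, for an ideal I of X.  For cosets C = x + I and D = y + I the sum is
   C + D = x + y + I, and the product is CD + I = x y + I. *)
Definition quotient_ring (X : preRing) (I : set X) : preRing :=
  @PreRing (set X) [set coset_of I x | x in @pr_dom X]
    (fun C D => [set z | exists x y, [/\ C x, D y & z = pr_add x y]])
    (fun C D => [set z | exists x y i,
                  [/\ C x, D y, I i & z = pr_add (pr_mul x y) i]]).

Record preFunctor := PreFunctor {
  fobj :> comNzRingType -> preRing;
  fmor : forall A B : comNzRingType, {rmorphism A -> B} -> fobj A -> fobj B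
}.

Arguments fmor _ [A B] f _.

Definition is_functor (F : preFunctor) : Prop :=
  [/\ forall A, is_comring (F A),
      forall (A B : comNzRingType) (f : {rmorphism A -> B}), is_ringhom (fmor F f),
      forall (A : comNzRingType) (x : F A),
        pr_dom x -> fmor F (idfun : {rmorphism A -> A}) x = x
    & forall (A B C : comNzRingType) (f : {rmorphism A -> B}) (g : {rmorphism B -> C})
          (x : F A),
        pr_dom x ->
        fmor F (g \o f : {rmorphism A -> C}) x = fmor F g (fmor F f x)].

Definition naturally_isomorphic (F F' : preFunctor) : Prop :=
  exists eta : forall A, F A -> F' A,
    [/\ forall A, is_ringhom (@eta A),
        forall A, set_bij (@pr_dom (F A)) (@pr_dom (F' A)) (@eta A)
      & forall (A B : comNzRingType) (f : {rmorphism A -> B}) (x : F A),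
        pr_dom x -> eta B (fmor F f x) = fmor F' f (eta A x)].

Definition ghost (G : profiniteGroupType) (A : comNzRingType)
    (U : opensub [set: G]) (x : classmap G A) : A :=
  \sum_(V \in [set V : ccl [set: G] | subconj setT U V])
    x V ^+ subconj_index setT V U *+ mark setT U V.

Definition W_prefunctor (G : profiniteGroupType)
    (add mul : forall A : comNzRingType,
      classmap G A -> classmap G A -> classmap G A) : preFunctor :=
  @PreFunctor (fun A => @PreRing (classmap G A) setT (add A) (mul A))
    (fun A B h => comp_classmap h).

(* The ghost maps are natural in A by construction. *)
Record wittBurnside (G : profiniteGroupType) := WittBurnside {
  W_add : forall A : comNzRingType, classmap G A -> classmap G A -> classmap G A;
  W_mul : forall A : comNzRingType, classmap G A -> classmap G A -> classmap G A;
  W_functor :> preFunctor := W_prefunctor W_add W_mul;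
  W_is_functor : is_functor W_functor;
  W_ghost : forall (A : comNzRingType) (U : opensub [set: G]),
    @is_ringhom (W_functor A) (preRing_of A) (@ghost G A U)
}.

(* Such a morphism is unique. *)
Definition contains_rat (R : comNzRingType) : Prop :=
  exists f : {rmorphism rat -> R}, injective f.

Definition torsion_free (R : comNzRingType) : Prop :=
  forall (n : nat) (x : R), x *+ n.+1 = 0 -> x = 0.

(* The ring R (x)_Z Q for R torsion-free, as the localization of R at the
   positive integers: the pair (a, n) stands for a (x) 1/(n+1). *)
Module RatHull.
Local Open Scope quotient_scope.
Section RatHull.
Variables (R : comNzRingType) (tfR : torsion_free R).
Implicit Types x y z : R * nat.

Definition eqv x y := x.1 *+ y.2.+1 == y.1 *+ x.2.+1.

Lemma mulrnI n : injective (fun x : R => x *+ n.+1).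
Proof.
by move=> x y /eqP; rewrite -subr_eq0 -mulrnBl => /eqP/tfR/eqP; rewrite subr_eq0 => /eqP.
Qed.

Lemma eqv_refl : reflexive eqv. Proof. by move=> x; rewrite /eqv. Qed.
Lemma eqv_sym : symmetric eqv. Proof. by move=> x y; rewrite /eqv eq_sym. Qed.
Lemma eqv_trans : transitive eqv.
Proof.
move=> y x z /eqP xy /eqP yz; apply/eqP; apply: (@mulrnI y.2).
by rewrite mulrnAC xy mulrnAC yz mulrnAC.
Qed.

Canonical eqv_equiv := EquivRel eqv eqv_refl eqv_sym eqv_trans.

Definition type := {eq_quot eqv}.
HB.instance Definition _ : EqQuotient _ eqv type := EqQuotient.on type.
HB.instance Definition _ := Choice.on type.

Definition addq x y : R * nat :=
  (x.1 *+ y.2.+1 + y.1 *+ x.2.+1, (x.2.+1 * y.2.+1).-1).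
Definition oppq x : R * nat := (- x.1, x.2).
Definition mulq x y : R * nat := (x.1 * y.1, (x.2.+1 * y.2.+1).-1).

Lemma predS2 m n : (m.+1 * n.+1).-1.+1 = (m.+1 * n.+1)%N. Proof. by []. Qed.

Lemma mulrnMM (a b : R) m n : (a * b) *+ (m * n) = (a *+ m) * (b *+ n).
Proof. by rewrite mulrnAl mulrnAr mulrnA mulrnAC. Qed.

Lemma eqv_repr x : (repr (\pi_type x)).1 *+ x.2.+1 = x.1 *+ (repr (\pi_type x)).2.+1.
Proof. by apply/eqP; rewrite -/(eqv _ x) -[eqv _ _]/(eqv_equiv _ _) -eqmodE reprK. Qed.

Definition add := lift_op2 type addq.
Lemma pi_add : {morph \pi : x y / addq x y >-> add x y}.
Proof.
move=> x y; unlock add; apply/eqmodP/eqP => /=; rewrite !predS2 !mulrnDl.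
set x' := repr _; set y' := repr _.
have hx : x'.1 *+ x.2.+1 = x.1 *+ x'.2.+1 by exact: eqv_repr.
have hy : y'.1 *+ y.2.+1 = y.1 *+ y'.2.+1 by exact: eqv_repr.
congr (_ + _); rewrite -!mulrnA.
- rewrite [in LHS](_ : _ * _ = x'.2.+1 * (y.2.+1 * y'.2.+1))%N; last by ring.
  rewrite [in RHS](_ : _ * _ = x.2.+1 * (y.2.+1 * y'.2.+1))%N; last by ring.
  by rewrite !mulrnA hx.
rewrite [in LHS](_ : _ * _ = y'.2.+1 * (x.2.+1 * x'.2.+1))%N; last by ring.
rewrite [in RHS](_ : _ * _ = y.2.+1 * (x.2.+1 * x'.2.+1))%N; last by ring.
by rewrite !mulrnA hy.
Qed.
Canonical pi_add_morph := PiMorph2 pi_add.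

Definition opp := lift_op1 type oppq.
Lemma pi_opp : {morph \pi : x / oppq x >-> opp x}.
Proof.
move=> x; unlock opp; apply/eqmodP/eqP => /=.
by rewrite !mulNrn eqv_repr.
Qed.
Canonical pi_opp_morph := PiMorph1 pi_opp.

Definition mul := lift_op2 type mulq.
Lemma pi_mul : {morph \pi : x y / mulq x y >-> mul x y}.
Proof.
move=> x y; unlock mul; apply/eqmodP/eqP => /=; rewrite !predS2.
by rewrite !mulrnMM -!eqv_repr.
Qed.
Canonical pi_mul_morph := PiMorph2 pi_mul.

Definition frac (a : R) (n : nat) : type := \pi_type (a, n).

Lemma fracP a n b m : reflect (frac a n = frac b m) (a *+ m.+1 == b *+ n.+1).
Proof. by apply: (iffP idP) => [h | /eqmodP //]; apply/eqmodP. Qed.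

Lemma quot_fracW (P : type -> Prop) :
  (forall a n, P (frac a n)) -> forall x : type, P x.
Proof. by move=> Pf; elim/quotW => -[a n]; apply: Pf. Qed.

Lemma addE a n b m : add (frac a n) (frac b m) =
  frac (a *+ m.+1 + b *+ n.+1) (n.+1 * m.+1).-1.
Proof. by rewrite -[add _ _]pi_add. Qed.

Lemma oppE a n : opp (frac a n) = frac (- a) n.
Proof. by rewrite -[opp _]pi_opp. Qed.

Lemma mulE a n b m : mul (frac a n) (frac b m) =
  frac (a * b) (n.+1 * m.+1).-1.
Proof. by rewrite -[mul _ _]pi_mul. Qed.

Lemma addA : associative add.
Proof.
elim/quot_fracW=> a n; elim/quot_fracW=> b m; elim/quot_fracW=> c p.
rewrite !addE !predS2 mulnA; congr frac.
rewrite !mulrnDl -!mulrnA addrA; congr (_ *+ _ + _ *+ _ + _ *+ _); ring.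
Qed.

Lemma addC : commutative add.
Proof.
by elim/quot_fracW=> a n; elim/quot_fracW=> b m; rewrite !addE addrC mulnC.
Qed.

Lemma add0 : left_id (frac 0 0) add.
Proof. by elim/quot_fracW=> a n; rewrite addE mul0rn add0r mul1n. Qed.

Lemma addN : left_inverse (frac 0 0) opp add.
Proof.
elim/quot_fracW=> a n; rewrite oppE addE; apply/fracP.
by rewrite mulNrn addNr !mul0rn.
Qed.

HB.instance Definition _ := GRing.isZmodule.Build type addA addC add0 addN.

Lemma mulA : associative mul.
Proof.
elim/quot_fracW=> a n; elim/quot_fracW=> b m; elim/quot_fracW=> c p.
by rewrite !mulE !predS2 mulnA mulrA.
Qed.

Lemma mulC : commutative mul.
Proof.
by elim/quot_fracW=> a n; elim/quot_fracW=> b m; rewrite !mulE mulrC mulnC.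
Qed.

Lemma mul1 : left_id (frac 1 0) mul.
Proof. by elim/quot_fracW=> a n; rewrite mulE mul1r mul1n. Qed.

Lemma mulDl : left_distributive mul add.
Proof.
elim/quot_fracW=> a n; elim/quot_fracW=> b m; elim/quot_fracW=> c p.
rewrite !(addE, mulE); apply/fracP/eqP; rewrite !predS2 mulrDl !mulrnDl.
rewrite !mulrnAl -!mulrnA; congr (_ *+ _ + _ *+ _); ring.
Qed.

Lemma one_neq0 : frac 1 0 != frac 0 0.
Proof. by apply/negP => /eqP/fracP; rewrite oner_eq0. Qed.

HB.instance Definition _ :=
  GRing.Zmodule_isComNzRing.Build type mulA mulC mul1 mulDl one_neq0.

Definition incl (a : R) : type := frac a 0.

Lemma incl_zmod_morphism : zmod_morphism incl.
Proof. by move=> a b; rewrite -[RHS]/(add _ (opp _)) oppE addE. Qed.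

Lemma incl_monoid_morphism : monoid_morphism incl.
Proof. by split=> // a b; rewrite -[RHS]/(mul _ _) mulE. Qed.

HB.instance Definition _ :=
  GRing.isZmodMorphism.Build R type incl incl_zmod_morphism.
HB.instance Definition _ :=
  GRing.isMonoidMorphism.Build R type incl incl_monoid_morphism.

Definition of_rat (q : rat) : type := frac (numq q)%:~R `|denq q|%N.-1.

Lemma absz_denqS q : `|denq q|%N.-1.+1 = `|denq q|%N.
Proof. by rewrite prednK // absz_gt0 denq_neq0. Qed.

Lemma rat_frac (q : rat) : q *+ `|denq q|%N.-1.+1 = (numq q)%:~R.
Proof.
rewrite absz_denqS numqE pmulrn -mulrzr.
by rewrite gez0_abs ?denq_ge0.
Qed.

Lemma of_rat_frac (q : rat) (z : int) (n : nat) :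
  q *+ n.+1 = z%:~R -> of_rat q = frac z%:~R n.
Proof.
move=> qz; apply/fracP/eqP.
have /intr_inj : ((numq q *+ n.+1)%:~R = (z *+ `|denq q|%N.-1.+1)%:~R :> rat).
  by rewrite !(rmorphMn intr) /= -qz -rat_frac mulrnAC.
by move=> /(congr1 (fun z : int => z%:~R : R)); rewrite !(rmorphMn intr).
Qed.

Lemma rat_fracM (p q : rat) m n : (p * q) *+ (m * n) = (p *+ m) * (q *+ n).
Proof. by rewrite mulrnAl mulrnAr mulrnA mulrnAC. Qed.

Lemma of_rat_zmod_morphism : zmod_morphism of_rat.
Proof.
move=> p q; rewrite -[RHS]/(add _ (opp _)) /of_rat oppE addE -/(of_rat _).
rewrite -(rmorphN intr) -!(rmorphMn intr) -(rmorphD intr).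
apply: of_rat_frac; rewrite (rmorphD intr) !(rmorphMn intr) (rmorphN intr) /=.
rewrite predS2 mulrnBl; congr (_ + _); first by rewrite mulrnA rat_frac.
by rewrite mulNrn mulnC mulrnA rat_frac.
Qed.

Lemma of_rat_monoid_morphism : monoid_morphism of_rat.
Proof.
split=> [|p q]; first exact: (@of_rat_frac 1 1 0).
rewrite -[RHS]/(mul _ _) /of_rat mulE -/(of_rat _) -(rmorphM intr).
by apply: of_rat_frac; rewrite (rmorphM intr) /= predS2 rat_fracM !rat_frac.
Qed.

HB.instance Definition _ :=
  GRing.isZmodMorphism.Build rat type of_rat of_rat_zmod_morphism.
HB.instance Definition _ :=
  GRing.isMonoidMorphism.Build rat type of_rat of_rat_monoid_morphism.

End RatHull.
End RatHull.
HB.export RatHull.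

Definition ratHull (R : comNzRingType) (tfR : torsion_free R) : comNzRingType :=
  RatHull.type tfR.

Definition ratHull_incl (R : comNzRingType) (tfR : torsion_free R) :
  {rmorphism R -> ratHull tfR} := @RatHull.incl R tfR.

Definition ratHull_rat (R : comNzRingType) (tfR : torsion_free R) :
  {rmorphism rat -> ratHull tfR} := @RatHull.of_rat R tfR.

Record cover (R : comNzRingType) := Cover {
  cover_ring : comNzRingType;
  cover_torsion_free : torsion_free cover_ring;
  cover_map : {rmorphism cover_ring -> R};
  cover_surj : forall r, exists s, cover_map s = r
}.

Record model (G : profiniteGroupType) (R : comNzRingType) := Model {
  Delta : preRing;
  tau : classmap G R -> Delta;
  AP : preRing;
  theta : Delta -> AP
}.

Section RationalCase.
Variables (G : profiniteGroupType) (R : comNzRingType) (q : {rmorphism rat -> R}).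

(* M_H(r,V) *)
Definition necklace (H : set G) (r : R) : ccl H -> R :=
  xget (fun=> 0) [set M : ccl H -> R | forall U : opensub H,
    \sum_(V \in [set V : ccl H | subconj H U V]) M V *+ mark H U V
      = r ^+ gindex H U].

(* Ind_H^G *)
Definition Ind (H : set G) (x : ccl H -> R) : ccl [set: G] -> R :=
  fun W => \sum_(V \in [set V : ccl H | conjugate setT V W]) x V.

Definition tauQ (alpha : classmap G R) : ccl [set: G] -> R :=
  fun W => \sum_(U \in [set: ccl [set: G]])
    Ind (@necklace U (alpha U)) W.

Definition pointwise_add (x y : ccl [set: G] -> R) : ccl [set: G] -> R :=
  fun U => x U + y U.

Definition Delta_mul (x y : ccl [set: G] -> R) : ccl [set: G] -> R :=
  fun U => \sum_(VW \in [set: ccl [set: G] * ccl [set: G]])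
    x VW.1 * y VW.2 *+ dcoset_count VW.1 VW.2 U.

(* The inner sum is over the double cosets D = V g W, with g := xget 1 D. *)
Definition AP_mul (x y : ccl [set: G] -> R) : ccl [set: G] -> R :=
  fun U => \sum_(VW \in [set: ccl [set: G] * ccl [set: G]])
    \sum_(D \in dcosets VW.1 VW.2 U)
      q (dcoset_coef VW.1 VW.2 (xget 1%g D)) * x VW.1 * y VW.2.

Definition thetaQ (x : ccl [set: G] -> R) : ccl [set: G] -> R :=
  fun U => x U *+ gindex setT U.

Definition rational_model : model G R :=
  @Model G R (PreRing setT pointwise_add Delta_mul) tauQ
    (PreRing setT pointwise_add AP_mul) thetaQ.

End RationalCase.

Section TorsionFreeCase.
Variables (G : profiniteGroupType) (R : comNzRingType) (tfR : torsion_free R).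

Let MQ := rational_model G (ratHull_rat tfR).
Let tau_incl (alpha : classmap G R) : Delta MQ :=
  tau MQ (comp_classmap (ratHull_incl tfR) alpha).

Definition integral_model : model G R :=
  @Model G R (sub_ring (range tau_incl)) tau_incl
    (sub_ring (theta (m := MQ) @` range tau_incl)) (@theta G _ MQ).

Definition torsion_free_model : model G R :=
  match pselect (contains_rat R) with
  | left h => rational_model G (projT1 (cid h))
  | right _ => integral_model
  end.

End TorsionFreeCase.

Section QuotientCase.
Variables (G : profiniteGroupType) (R : comNzRingType) (rho : cover R).

Let M := torsion_free_model G (@cover_torsion_free R rho).

Definition W_ker : set (classmap G (cover_ring rho)) :=
  [set alpha | forall U, cover_map rho (alpha U) = 0].
Definition Delta_ker : set (Delta M) := tau M @` W_ker.
Definition AP_ker : set (AP M) := theta (m := M) @` Delta_ker.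

(* The image of alpha in Delta_G(R')/Delta_G(ker rho) is the coset of
   tau(beta), for any beta in W_G(R') that lifts alpha; the image of a coset C
   in AP_G(R')/AP_G(ker rho) is the coset of theta(x), for any x in C. *)
Definition quotient_model : model G R :=
  @Model G R
    (quotient_ring Delta_ker)
    (fun alpha => [set y | exists beta : classmap G (cover_ring rho),
       (forall U, cover_map rho (beta U) = alpha U)
       /\ coset_of Delta_ker (tau M beta) y])
    (quotient_ring AP_ker)
    (fun C => [set z | exists2 x, C x & coset_of AP_ker (theta x) z]).

End QuotientCase.

(* A choice of the morphisms rho used for the rings with torsion. *)
Definition cover_choice : Type :=
  forall R : comNzRingType, ~ torsion_free R -> cover R.

Section Functors.
Variables (G : profiniteGroupType) (rho : cover_choice).

(* A ring containing the rationals is torsion-free. *)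
Definition the_model (R : comNzRingType) : model G R :=
  match pselect (torsion_free R) with
  | left h => torsion_free_model G h
  | right h => quotient_model G (rho h)
  end.

(* s(x) |-> t(f o x); the maps s below are injective. *)
Definition transport (A B : comNzRingType) (X Y : Type)
    (s : classmap G A -> X) (t : classmap G B -> Y) (f : A -> B) (u : X) : Y :=
  t (comp_classmap f (xget (const_classmap G 0) [set x | s x = u])).

Definition Delta_functor : preFunctor :=
  @PreFunctor (fun R => Delta (the_model R))
    (fun A B f => transport (tau (the_model A)) (tau (the_model B)) f).

Definition AP_functor : preFunctor :=
  @PreFunctor (fun R => AP (the_model R))
    (fun A B f => transport (@theta _ _ (the_model A) \o tau (the_model A))
                            (@theta _ _ (the_model B) \o tau (the_model B)) f).

End Functors.

(* Main.v *)
(** The marks [x |-> sum_V phi_U(G/V) x_V], for [U] open, are jointly injective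
    ring homomorphisms on [Delta_G(R)] when [R] contains the rationals, since the
    matrix of the [phi_U(G/V)] is triangular with invertible diagonal and since
    [G/V * G/W] splits into the orbits [G/Z(g,V,W)].  Decomposing the [U]-fixed
    points of [G/V] along [G/V -> G/H] shows that the marks of [tau alpha] are
    the ghost components of [alpha]; hence [tau] is a ring isomorphism from
    [W_G(R)], and so is [theta o tau], as [theta] is a rescaling that turns one
    product into the other.  The other two cases transport this along an
    injection [W_G(R) -> W_G(RQ)] and a surjection [W_G(R') -> W_G(R)] with kernel
    [W_G(ker rho)].  For every ring [R], [Delta_G(R)] and [AP_G(R)] are thus copies
    of the ring [W_G(R)], and the morphisms correspond by construction. *)

From HB Require Import structures.
Require Import Defs.
From mathcomp Require Import all_boot.
From mathcomp Require Import all_order all_algebra finmap.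
From mathcomp Require Import boolp classical_sets functions cardinality fsbigop.
From mathcomp Require Import topology ring.

Set Implicit Arguments.
Unset Strict Implicit.
Unset Printing Implicit Defensive.
Import GRing.Theory Num.Theory.
Local Open Scope classical_set_scope.
Local Open Scope card_scope.
Local Open Scope ring_scope.

(** * Counting finite sets and summing along fibres *)

Lemma ncard_infinite (T : choiceType) (A : set T) :
  ~ finite_set A -> ncard A = 0%N.
Proof. by move=> Ainf; rewrite /ncard /fset_set; case: pselect. Qed.

(** Finiteness is not assumed: the two sets are finite together, and otherwise both counts are the
    default 0. *)
Lemma ncard_can (S T : choiceType) (A : set S) (B : set T) (f : S -> T)
    (g : T -> S) :
  (forall x, A x -> B (f x)) -> (forall y, B y -> A (g y)) ->
  (forall x, A x -> g (f x) = x) -> (forall y, B y -> f (g y) = y) ->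
  ncard A = ncard B.
Proof.
move=> fAB gBA fK gK.
have BE : B = f @` A.
  by apply/seteqP; split=> [y By|_ [x Ax <-]]; [exists (g y); auto|auto].
have AE : A = g @` B.
  by apply/seteqP; split=> [x Ax|_ [y By <-]]; [exists (f x); auto|auto].
have [Afin|Ainf] := pselect (finite_set A); last first.
  rewrite !ncard_infinite // => Bfin; apply: Ainf; rewrite AE.
  exact: finite_image.
rewrite BE /ncard fset_set_image // card_in_imfset // => x y.
by rewrite !in_fset_set // !inE => Ax Ay /(congr1 g); rewrite !fK.
Qed.

Lemma fsumr_const (R : nmodType) (T : choiceType) (A : set T) (r : R) :
  finite_set A -> \sum_(x \in A) r = r *+ ncard A.
Proof.
move=> Afin; rewrite fsbig_finite // big_const_seq count_predT.
by rewrite /ncard; elim: (size _) => //= n ->; rewrite mulrS.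
Qed.

Lemma fsumr_ncard (T : choiceType) (A : set T) :
  finite_set A -> \sum_(x \in A) 1%N = ncard A :> nat.
Proof. by move=> Afin; rewrite fsumr_const // natn. Qed.

Lemma ncard0 (T : choiceType) : ncard (@set0 T) = 0%N.
Proof. by rewrite /ncard fset_set0 cardfs0. Qed.

Lemma ncard1 (T : choiceType) (x : T) : ncard [set x] = 1%N.
Proof. by rewrite /ncard fset_set1 cardfs1. Qed.

Lemma ncard_gt0 (T : choiceType) (A : set T) (x : T) :
  finite_set A -> A x -> (0 < ncard A)%N.
Proof.
move=> Afin Ax; rewrite /ncard cardfs_gt0; apply/fset0Pn; exists x.
by rewrite in_fset_set // inE.
Qed.

Lemma ncard_proper (T : choiceType) (A B : set T) :
  finite_set B -> A `<` B -> (ncard A < ncard B)%N.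
Proof.
move=> Bfin; rewrite properEneq => -[AB sAB]; have Afin := sub_finite_set sAB Bfin.
apply: fproper_ltn_card; rewrite fproperEneq; apply/andP; split.
  by apply: contra_neq AB => /fset_set_inj ->.
by rewrite -fset_set_sub.
Qed.

Lemma ncardX (S T : choiceType) (A : set S) (B : set T) :
  finite_set A -> finite_set B -> ncard (A `*` B) = (ncard A * ncard B)%N.
Proof.
move=> Afin Bfin; rewrite -fsumr_ncard; last exact: finite_setX.
rewrite -(@pair_fsbig _ _ _ _ _ A B (fun _ _ => 1%N)) //.
under eq_fsbigr do rewrite fsumr_ncard //.
by rewrite fsumr_const // -mulr_natl natn.
Qed.

(** After the two sums are exchanged, each [x] meets the single index [y = f x]. *)
Lemma fsumr_fibre (R : nmodType) (S T : choiceType) (A : set S) (B : set T)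
    (f : S -> T) (F : S -> R) :
  finite_set A -> finite_set B -> (forall x, A x -> B (f x)) ->
  \sum_(x \in A) F x = \sum_(y \in B) \sum_(x \in A `&` f @^-1` [set y]) F x.
Proof.
move=> Afin Bfin fAB.
under [RHS]eq_fsbigr do rewrite fsbig_mkcondr.
rewrite exchange_fsbig //; apply: eq_fsbigr => x /set_mem/fAB Bfx.
rewrite -(@fsbig_widen _ _ _ _ [set f x]) ?fsbig_set1.
- by rewrite mem_set.
- by move=> _ ->.
- move=> y [_ /= yfx]; rewrite memNset // => /= xy; exact: yfx.
Qed.

Lemma ncard_fibre (S T : choiceType) (A : set S) (B : set T) (f : S -> T) :
  finite_set A -> finite_set B -> (forall x, A x -> B (f x)) ->
  ncard A = \sum_(y \in B) ncard (A `&` f @^-1` [set y]).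
Proof.
move=> Afin Bfin fAB; rewrite -fsumr_ncard // (fsumr_fibre _ Afin Bfin fAB).
by apply: eq_fsbigr => y _; rewrite fsumr_ncard //; exact: finite_setIl.
Qed.

(** * Cosets, conjugates, fixed points and indices *)

Section Cosets.
Local Open Scope group_scope.
Variable G : profiniteGroupType.
Implicit Types (A C D E H U V W X : set G) (a b g h u v w x y : G).

(** Rewriting rules that associate a word to the left and cancel adjacent inverse elements. *)
Definition mulg_simp := (@invgM G, @invgK G, @invg1 G, @mulgA G, @mulgK G, @mulgVK G,
  @mulVg G, @mulgV G, @mul1g G, @mulg1 G).

Definition lmulset g C : set G := [set (g * c) | c in C].
Definition mulset C D : set G := [set x | exists c d, [/\ C c, D d & x = (c * d)]].
(** The set counted by [mark H U V]: the [U]-fixed points of [H/V]. *)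
Definition fixcosets H U V : set (set G) :=
  [set C | lcosets H V C /\ forall u, U u -> lmulset u C = C].

Lemma lmulsetE g C : lmulset g C = [set x | C (g^-1 * x)].
Proof.
apply/seteqP; split=> [_ [c Cc <-] /=|x /= Cx]; first by rewrite mulKg.
by exists (g^-1 * x); rewrite // mulVKg.
Qed.

Lemma conjsetE g C : conjset g C = [set x | C (g^-1 * x * g)].
Proof.
apply/seteqP; split=> [_ [c Cc <-] /=|x /= Cx]; first by rewrite mulgA mulKg mulgVK.
by exists (g^-1 * x * g); rewrite // !mulgA mulgV mul1g mulgK.
Qed.

Lemma lmulset1 C : lmulset 1 C = C.
Proof. by rewrite lmulsetE; apply/seteqP; split=> x /=; rewrite invg1 mul1g. Qed.

Lemma lmulsetM g h C : lmulset (g * h) C = lmulset g (lmulset h C).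
Proof. by rewrite !lmulsetE; apply/seteqP; split=> x /=; rewrite invgM mulgA. Qed.

Lemma conjset1 C : conjset 1 C = C.
Proof. by rewrite conjsetE; apply/seteqP; split=> x /=; rewrite invg1 mul1g mulg1. Qed.

Lemma conjsetM g h C : conjset (g * h) C = conjset g (conjset h C).
Proof.
by rewrite !conjsetE; apply/seteqP; split=> x /=; rewrite invgM !mulgA.
Qed.

Lemma conjsetK g : cancel (@conjset G g) (conjset g^-1).
Proof. by move=> C; rewrite -conjsetM mulVg conjset1. Qed.

Lemma conjsetVK g : cancel (conjset g^-1) (@conjset G g).
Proof. by move=> C; rewrite -conjsetM mulgV conjset1. Qed.

Lemma conjsetS g C D : C `<=` D -> conjset g C `<=` conjset g D.
Proof. exact: image_subset. Qed.

Lemma conjset_set1 g : conjset g [set 1] = [set 1].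
Proof. by rewrite /conjset image_set1 mulg1 mulgV. Qed.

Lemma conjset_subgroup g V : is_subgroup V -> is_subgroup (conjset g V).
Proof.
move=> [V1 VM VV]; rewrite conjsetE; split=> /=; first by rewrite mulg1 mulVg.
- move=> x y Vx Vy; rewrite (_ : _ * g = (g^-1 * x * g) * (g^-1 * y * g)).
    exact: VM.
  by rewrite !mulg_simp.
- by move=> x /VV; rewrite !invgM invgK mulgA.
Qed.

Lemma conjset_id V v : is_subgroup V -> V v -> conjset v V = V.
Proof.
move=> [V1 VM VV] Vv; rewrite conjsetE; apply/seteqP; split=> x /= Vx.
  rewrite (_ : x = v * (v^-1 * x * v) * v^-1); last by rewrite !mulg_simp.
  by apply: (VM) => //; [apply: VM|apply: VV].
by apply: (VM) => //; apply: VM => //; apply: VV.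
Qed.

Lemma conjset_subid H h V : is_subgroup H -> H h -> V `<=` H -> conjset h V `<=` H.
Proof. by move=> sgH Hh /(@conjsetS h); rewrite (conjset_id sgH). Qed.

Lemma subgroup_setT : is_subgroup [set: G].
Proof. by []. Qed.

Lemma subgroup_setI V W : is_subgroup V -> is_subgroup W -> is_subgroup (V `&` W).
Proof.
move=> [V1 VM VV] [W1 WM WV]; split=> // [x y [Vx Wx] [Vy Wy]|x [Vx Wx]].
  by split; auto.
by split; auto.
Qed.

Lemma Zint_subgroup g V W : is_subgroup V -> is_subgroup W -> is_subgroup (Zint g V W).
Proof. by move=> sgV sgW; apply: subgroup_setI => //; apply: conjset_subgroup. Qed.

Lemma lmulset_eqP a b V : is_subgroup V -> (lmulset a V = lmulset b V) <-> V (a^-1 * b).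
Proof.
move=> [V1 VM VV]; split=> [ab|Vab].
  have : lmulset b V b by rewrite lmulsetE /= mulVg.
  by rewrite -ab lmulsetE.
rewrite !lmulsetE; apply/seteqP; split=> x /= Vx.
  have -> : (b^-1 * x = (a^-1 * b)^-1 * (a^-1 * x)) by rewrite invgM invgK mulgA mulgK.
  by auto.
have -> : (a^-1 * x = (a^-1 * b) * (b^-1 * x)) by rewrite mulgA mulgK.
by auto.
Qed.

Lemma lmulset_mem a V : is_subgroup V -> lmulset a V a.
Proof. by move=> [V1 _ _]; rewrite lmulsetE /= mulVg. Qed.

Lemma lmulset_repr a b V : is_subgroup V -> lmulset a V b -> lmulset b V = lmulset a V.
Proof. by move=> sgV; rewrite {1}lmulsetE /= => Vab; apply/esym/(lmulset_eqP _ _ sgV). Qed.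

(** An element [u] fixes [aV] exactly when [a^-1 u a] lies in [V]. *)
Lemma fixcosetsP H U V C : is_subgroup V ->
  fixcosets H U V C <-> exists a, [/\ H a, C = lmulset a V & U `<=` conjset a V].
Proof.
move=> sgV; split=> [[[a Ha aC] UC]|[a [Ha -> UaV]]].
  exists a; split=> // u /UC; rewrite -aC -/(lmulset a V) -lmulsetM => uaV.
  rewrite conjsetE /= -mulgA; apply/(lmulset_eqP _ _ sgV).
  exact/esym.
split; first by exists a.
move=> u /UaV; rewrite conjsetE /= -mulgA -lmulsetM => Vu.
by apply/esym/(lmulset_eqP _ _ sgV).
Qed.

Lemma markE H U V : mark H U V = ncard (fixcosets H U V). Proof. by []. Qed.

(** The trivial group fixes every coset, so facts about indices are special cases of facts about
    marks. *)
Lemma gindexE H V : gindex H V = mark H [set 1] V.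
Proof.
rewrite /gindex markE; congr ncard; apply/seteqP; split=> [C HC|C []//].
by split=> // u ->; rewrite lmulset1.
Qed.

Lemma finite_fixcosets H U V : finite_set (lcosets setT V) -> finite_set (fixcosets H U V).
Proof. by apply: sub_finite_set => C [[a _ aC] _]; exists a. Qed.

Lemma finite_lcosets H V : finite_set (lcosets setT V) -> finite_set (lcosets H V).
Proof. by apply: sub_finite_set => C [a _ aC]; exists a. Qed.

(** Since [Z] lies in [g W g^-1], it stabilises the point [gW]. This makes [cZ |-> cgW] a
    well-defined map [G/Z -> G/W]. *)
Lemma mulset_lmulset c Z g W : is_subgroup W -> Z 1 -> Z `<=` conjset g W ->
  mulset (lmulset c Z) (lmulset g W) = lmulset (c * g) W.
Proof.
move=> [W1 WM WV] Z1 ZgW; apply/seteqP; split=> [_ [_ [_ [[z Zz <-] [w Ww <-] ->]]]|_ [w Ww <-]].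
  have [w' Ww' <-] := ZgW z Zz; exists (w' * w); first exact: WM.
  by rewrite !mulg_simp.
exists c, (g * w); rewrite mulgA; split=> //; last by exists w.
by exists 1; rewrite ?mulg1.
Qed.

(** Right multiplication by [H] is thus the projection [G/V -> G/H]. *)
Lemma mulset_lcoset a V H : is_subgroup V -> is_subgroup H -> V `<=` H ->
  mulset (lmulset a V) H = lmulset a H.
Proof.
move=> [V1 _ _] sgH VH; rewrite -{1}(lmulset1 H) mulset_lmulset ?mulg1 //.
by rewrite conjset1.
Qed.

Lemma finite_lcosetsS H V : is_subgroup V -> is_subgroup H -> V `<=` H ->
  finite_set (lcosets setT V) -> finite_set (lcosets setT H).
Proof.
move=> sgV sgH VH /(@finite_image _ _ _ (fun C => mulset C H)).
apply: sub_finite_set => _ [a _ <-]; exists (lmulset a V); first by exists a.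
by rewrite mulset_lcoset.
Qed.

Lemma conjset_subV g C D : conjset g^-1 C `<=` D <-> C `<=` conjset g D.
Proof.
split=> [/(@conjsetS g)|/(@conjsetS g^-1)]; first by rewrite conjsetVK.
by rewrite conjsetK.
Qed.

(** A fixed point [gV] is the same as a conjugate [g V g^-1] containing [U]. Finiteness enters
    because [ncard] of an infinite set is 0. *)
Lemma mark_gt0P H U V : is_subgroup V -> finite_set (lcosets setT V) ->
  (0 < mark H U V)%N <-> subconj H U V.
Proof.
move=> sgV Vfin; rewrite markE; split=> [|[g Hg UgV]]; last first.
  apply: (@ncard_gt0 _ _ (lmulset g V)); first exact: finite_fixcosets.
  by apply/fixcosetsP => //; exists g.
apply: contraPP => UV; rewrite (_ : fixcosets H U V = set0) ?ncard0 //.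
apply/seteqP; split=> // C /(fixcosetsP _ _ _ sgV)[a [Ha _ UaV]].
by apply: UV; exists a.
Qed.

Lemma mark_eq0 H U V : is_subgroup V -> finite_set (lcosets setT V) ->
  ~ subconj H U V -> mark H U V = 0%N.
Proof.
move=> sgV Vfin UV; apply/eqP; rewrite -leqn0 leqNgt; apply/negP.
by move=> /(mark_gt0P _ _ sgV Vfin).
Qed.

Lemma gindex_gt0 H V : is_subgroup H -> is_subgroup V ->
  finite_set (lcosets setT V) -> (0 < gindex H V)%N.
Proof.
move=> [H1 _ _] sgV Vfin; rewrite gindexE; apply/(mark_gt0P _ _ sgV Vfin).
by exists 1 => // _ ->; rewrite conjset1; case: sgV.
Qed.

(** The right translation [C |-> Ch] sends [a (h V h^-1)] to [ahV] and commutes with the left action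
    of [U]. *)
Lemma mark_conjr h H U V : is_subgroup H -> H h -> is_subgroup V ->
  mark H U (conjset h V) = mark H U V.
Proof.
move=> [H1 HM HV] Hh sgV; have sgV' := conjset_subgroup h sgV.
have rmulE k C : mulset C [set k] = [set x | C (x * k^-1)].
  apply/seteqP; split=> [_ [c [_ [Cc -> ->]]]|x /= Cx]; first by rewrite /= mulgK.
  by exists (x * k^-1), k; split=> //; rewrite mulgVK.
have rmulK k C : mulset (mulset C [set k]) [set k^-1] = C.
  by rewrite !rmulE; apply/seteqP; split=> x /=; rewrite !mulg_simp.
have rmulV a k C : mulset (lmulset a C) [set k] = lmulset (a * k) (conjset k^-1 C).
  by rewrite rmulE !lmulsetE conjsetE; apply/seteqP; split=> x /=; rewrite !mulg_simp.
rewrite !markE.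
apply: (@ncard_can _ _ _ _ (fun C => mulset C [set h]) (fun C => mulset C [set h^-1])).
- move=> C /(fixcosetsP _ _ _ sgV')[a [Ha -> UaV]]; apply/fixcosetsP => //.
  exists (a * h); split; [exact: HM|by rewrite rmulV conjsetK|].
  by rewrite conjsetM.
- move=> C /(fixcosetsP _ _ _ sgV)[a [Ha -> UaV]]; apply/fixcosetsP => //.
  exists (a * h^-1); split; [by apply: HM => //; apply: HV|by rewrite rmulV invgK|].
  by rewrite conjsetM conjsetK.
- by move=> C _; rewrite rmulK.
- by move=> C _; rewrite -{2}(invgK h) rmulK.
Qed.

(** Left translation by [h^-1] sends the fixed points of [h U h^-1] to those of [U]. *)
Lemma mark_conjl h H U V : is_subgroup H -> H h -> is_subgroup V ->
  mark H (conjset h U) V = mark H U V.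
Proof.
move=> [H1 HM HV] Hh sgV; rewrite !markE.
apply: (@ncard_can _ _ _ _ (lmulset h^-1) (lmulset h)).
- move=> C /(fixcosetsP _ _ _ sgV)[a [Ha -> UaV]]; apply/fixcosetsP => //.
  exists (h^-1 * a); split; [by apply: HM => //; apply: HV|by rewrite lmulsetM|].
  by rewrite conjsetM -conjset_subV invgK.
- move=> C /(fixcosetsP _ _ _ sgV)[a [Ha -> UaV]]; apply/fixcosetsP => //.
  exists (h * a); split; [exact: HM|by rewrite lmulsetM|].
  by rewrite conjsetM; exact: conjsetS.
- by move=> C _; rewrite -lmulsetM mulgV lmulset1.
- by move=> C _; rewrite -lmulsetM mulVg lmulset1.
Qed.

Lemma gindex_conj h H V : is_subgroup H -> H h -> is_subgroup V ->
  gindex H (conjset h V) = gindex H V.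
Proof. by move=> sgH Hh sgV; rewrite !gindexE mark_conjr. Qed.

Lemma xget_lcoset C H : is_subgroup H -> lcosets setT H C ->
  lmulset (xget 1 C) H = C.
Proof.
move=> sgH [a _ <-]; apply: lmulset_repr => //; apply: xgetPex.
by exists a; apply: lmulset_mem.
Qed.

(* The fibre of [G/V -> G/H] over [gH] is [gH/V], and [U] fixes a point [ghV] of
   it if and only if [g^-1 U g] fixes [hV]. *)
Lemma mark_tower U V H : is_subgroup V -> is_subgroup H -> V `<=` H ->
  finite_set (lcosets setT V) ->
  mark setT U V
    = \sum_(C \in fixcosets setT U H) mark H (conjset (xget 1 C)^-1 U) V.
Proof.
move=> sgV sgH VH Vfin; have Hfin := finite_lcosetsS sgV sgH VH Vfin.
rewrite markE (@ncard_fibre _ _ _ (fixcosets setT U H) (fun C => mulset C H));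
  [|exact: finite_fixcosets|exact: finite_fixcosets|]; last first.
  move=> C /(fixcosetsP _ _ _ sgV)[a [_ -> UaV]]; apply/(fixcosetsP _ _ _ sgH).
  by exists a; split; rewrite ?mulset_lcoset //; apply: subset_trans (conjsetS VH).
apply: eq_fsbigr => C /set_mem[/(xget_lcoset sgH)]; set g := xget 1 C => gC UC.
rewrite markE; apply: (@ncard_can _ _ _ _ (lmulset g^-1) (lmulset g)).
- move=> D [/(fixcosetsP _ _ _ sgV)[a [_ -> UaV]] /=].
  rewrite mulset_lcoset // -gC => /esym/(lmulset_eqP _ _ sgH) Hga.
  apply/(fixcosetsP _ _ _ sgV); exists (g^-1 * a); rewrite lmulsetM conjsetM; split=> //.
  exact: conjsetS.
- move=> D /(fixcosetsP _ _ _ sgV)[h [Hh -> UhV]]; split.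
    apply/(fixcosetsP _ _ _ sgV); exists (g * h); rewrite lmulsetM conjsetM; split=> //.
    by rewrite -conjset_subV.
  rewrite /= -lmulsetM mulset_lcoset // -gC; apply/esym/(lmulset_eqP _ _ sgH).
  by rewrite mulKg.
- by move=> D _; rewrite -lmulsetM mulgV lmulset1.
- by move=> D _; rewrite -lmulsetM mulVg lmulset1.
Qed.

(** This is [mark_tower] for the trivial group: its conjugates are trivial, so every fibre of
    [G/V -> G/H] has [(H:V)] points. *)
Lemma gindex_tower V H : is_subgroup V -> is_subgroup H -> V `<=` H ->
  finite_set (lcosets setT V) ->
  gindex setT V = (gindex setT H * gindex H V)%N.
Proof.
move=> sgV sgH VH Vfin; have Hfin := finite_lcosetsS sgV sgH VH Vfin.
rewrite gindexE (mark_tower _ sgV sgH VH Vfin).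
under eq_fsbigr do rewrite conjset_set1 -gindexE.
rewrite fsumr_const; last exact: finite_fixcosets.
by rewrite -markE -gindexE -mulr_natr natn mulnC.
Qed.

(** For [x] in [H] outside [V], the cosets [V] and [xV] of [H/V] differ, so [(H:V) > 1]. *)
Lemma gindex_proper V H : is_subgroup V -> is_subgroup H -> V `<` H ->
  finite_set (lcosets setT V) -> (gindex setT H < gindex setT V)%N.
Proof.
move=> sgV sgH [VH HV] Vfin; have Hfin := finite_lcosetsS sgV sgH VH Vfin.
rewrite (gindex_tower sgV sgH VH Vfin) ltn_Pmulr //; last exact: gindex_gt0.
have [x Hx Vx] : exists2 x, H x & ~ V x.
  by apply: contrapT => /forall2NP E; apply: HV => x Hx; have [|/contrapT] := E x.
rewrite -[X in (X < _)%N](ncard1 V); apply: ncard_proper; first exact: finite_lcosets.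
split=> [_ ->|E]; first by exists 1; [case: sgH|exact: lmulset1].
apply: Vx; have : V = lmulset x V.
  by apply/esym/E; exists x.
by rewrite -{1}(lmulset1 V) => /(lmulset_eqP _ _ sgV); rewrite invg1 mul1g.
Qed.

End Cosets.

(** * Double cosets and the orbits of [G/V * G/W] *)

Section DoubleCosets.
Local Open Scope group_scope.
Variable G : profiniteGroupType.
Implicit Types (A C D E H U V W X : set G) (a b g h u v w x y : G).

Let mulg_simp := mulg_simp G.

Definition double_cosets V W : set (set G) := [set D | exists g, D = dcoset V g W].
(** The set [C^-1 D]; for [C = aV] and [D = bW] it is the double coset [V a^-1 b W] that labels the
    orbit of [(aV, bW)]. *)
Definition ldivset C D : set G := [set x | exists c d, [/\ C c, D d & x = c^-1 * d]].

Lemma dcoset_mem V g W : is_subgroup V -> is_subgroup W -> dcoset V g W g.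
Proof. by move=> [V1 _ _] [W1 _ _]; exists 1, 1; rewrite mul1g mulg1. Qed.

Lemma dcoset_repr V g W x : is_subgroup V -> is_subgroup W ->
  dcoset V g W x -> dcoset V x W = dcoset V g W.
Proof.
move=> [V1 VM VV] [W1 WM WV] [v [w [Vv Ww ->]]]; apply/seteqP; split.
  move=> _ [v' [w' [Vv' Ww' ->]]]; exists (v' * v), (w * w').
  by rewrite !mulg_simp; split; auto.
move=> _ [v' [w' [Vv' Ww' ->]]]; exists (v' * v^-1), (w^-1 * w').
by rewrite !mulg_simp; split; auto.
Qed.

(** For [x = v g w] one has [V = v V v^-1] and [x W x^-1 = v (g W g^-1) v^-1]. Hence the class of
    [Zint g V W] depends only on the double coset. *)
Lemma Zint_repr V g W x : is_subgroup V -> is_subgroup W -> dcoset V g W x ->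
  exists2 v, V v & Zint x V W = conjset v (Zint g V W).
Proof.
move=> sgV sgW [v [w [Vv Ww ->]]]; exists v => //.
rewrite /Zint !conjsetM (conjset_id sgW Ww) -{1}(conjset_id sgV Vv).
by rewrite !conjsetE; apply/seteqP; split.
Qed.

Lemma xget_dcoset V W D : is_subgroup V -> is_subgroup W -> double_cosets V W D ->
  D = dcoset V (xget 1 D) W.
Proof.
move=> sgV sgW [g ->]; apply/esym/dcoset_repr => //; apply: xgetPex.
by exists g; apply: dcoset_mem.
Qed.

(** The map [gW |-> V gW] from [G/W] onto the double cosets is surjective. *)
Lemma finite_double_cosets V W : finite_set (lcosets setT W) ->
  finite_set (double_cosets V W).
Proof.
move=> /(@finite_image _ _ _ (mulset V)); apply: sub_finite_set => _ [g ->].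
exists (lmulset g W); first by exists g.
apply/seteqP; split=> [_ [v [_ [Vv [w Ww <-] ->]]]|_ [v [w [Vv Ww ->]]]].
  by exists v, w; rewrite mulgA.
by exists v, (g * w); rewrite mulgA; split=> //; exists w.
Qed.

Lemma ldivset_lcosets a b V W : is_subgroup V ->
  ldivset (lmulset a V) (lmulset b W) = dcoset V (a^-1 * b) W.
Proof.
move=> [V1 VM VV]; apply/seteqP; split=> [_ [_ [_ [[v Vv <-] [w Ww <-] ->]]]|_ [v [w [Vv Ww ->]]]].
  by exists v^-1, w; rewrite !mulg_simp; split; auto.
exists (a * v^-1), (b * w); rewrite !mulg_simp; split=> //; last by exists w.
by exists v^-1; auto.
Qed.

Lemma conjset_setI g C D : conjset g (C `&` D) = conjset g C `&` conjset g D.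
Proof. by rewrite !conjsetE; apply/seteqP; split. Qed.

(* The orbits of [G/V * G/W] correspond to the double cosets, [(aV, bW)] lying
   in the orbit of [V a^-1 b W]; the stabiliser of [(cV, cgW)] is
   [c Z(g,V,W) c^-1]. *)
Lemma mark_mul U V W : is_subgroup V -> is_subgroup W ->
  finite_set (lcosets setT V) -> finite_set (lcosets setT W) ->
  (mark setT U V * mark setT U W)%N
    = \sum_(D \in double_cosets V W) mark setT U (Zint (xget 1 D) V W).
Proof.
move=> sgV sgW Vfin Wfin; rewrite !markE -ncardX; try exact: finite_fixcosets.
rewrite (@ncard_fibre _ _ _ (double_cosets V W) (fun P => ldivset P.1 P.2)).
- apply: eq_fsbigr => D /set_mem /(xget_dcoset sgV sgW); set g := xget 1 D => DE.
  have sgZ := Zint_subgroup g sgV sgW; have [Z1 _ _] := sgZ.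
  rewrite markE.
  (* The pair [(cV, cgW)] corresponds to the point [cZ] of [G/Z], recovered as the intersection of
     [cV] with [cgW g^-1]. *)
  have capE c : lmulset c V `&` [set x | lmulset (c * g) W (x * g)] = lmulset c (Zint g V W).
    rewrite /Zint conjsetE !lmulsetE; apply/seteqP.
    by split=> x /= []; rewrite !mulg_simp.
  have mulV c : mulset (lmulset c (Zint g V W)) V = lmulset c V.
    by apply: mulset_lcoset => // x [].
  have mulW c : mulset (lmulset c (Zint g V W)) (lmulset g W) = lmulset (c * g) W.
    by apply: mulset_lmulset => // x [].
  have key C D' : (fixcosets setT U V `*` fixcosets setT U W
      `&` (fun P => ldivset P.1 P.2) @^-1` [set D]) (C, D') ->
    exists c, [/\ C = lmulset c V, D' = lmulset (c * g) W & U `<=` conjset c (Zint g V W)].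
    move=> [[]] /(fixcosetsP _ _ _ sgV)[a [_ /= -> UaV]]
      /(fixcosetsP _ _ _ sgW)[b [_ /= -> UbW]] /=.
    rewrite ldivset_lcosets // => abD.
    have : dcoset V g W (a^-1 * b) by rewrite -DE -abD; apply: dcoset_mem.
    move=> [v [w [Vv Ww ab]]]; have bE : b = a * v * g * w.
      by rewrite -(mulVKg a b) ab !mulgA.
    rewrite {}bE in UbW *.
    (* From [a^-1 b = v g w], the element [c = a v] satisfies [aV = cV] and [bW = cgW]. *)
    exists (a * v); split.
    - by apply/lmulset_eqP; rewrite ?mulKg.
    - by apply/esym/lmulset_eqP; rewrite ?mulKg.
    rewrite conjset_setI subsetI !conjsetM (conjset_id sgV Vv); split=> //.
    by move: UbW; rewrite !conjsetM (conjset_id sgW Ww).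
  apply: (@ncard_can _ _ _ _
    (fun P => P.1 `&` [set x | P.2 (x * g)])
    (fun E => (mulset E V, mulset E (lmulset g W)))).
  + by move=> [C D'] /key[c [-> -> UZ]]; apply/(fixcosetsP _ _ _ sgZ); exists c; rewrite capE.
  + move=> E /(fixcosetsP _ _ _ sgZ)[c [_ -> UZ]]; rewrite mulV mulW; split; last first.
      by rewrite /= ldivset_lcosets // !mulg_simp DE.
    by move: UZ; rewrite conjset_setI -conjsetM subsetI => -[UV UW];
      split; apply/fixcosetsP => //; [exists c|exists (c * g)].
  + by move=> [C D'] /key[c [-> -> UZ]]; rewrite capE mulV mulW.
  + by move=> E /(fixcosetsP _ _ _ sgZ)[c [_ -> UZ]]; rewrite mulV mulW capE.
- by apply: finite_setX; exact: finite_fixcosets.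
- exact: finite_double_cosets.
- move=> [C D'] [] /(fixcosetsP _ _ _ sgV)[a [_ -> _]] /(fixcosetsP _ _ _ sgW)[b [_ -> _]] /=.
  by rewrite ldivset_lcosets //; exists (a^-1 * b).
Qed.
End DoubleCosets.

(** * Open subgroups, finiteness from compactness, and conjugacy classes *)

Lemma xget_irr (T : choiceType) (x0 x1 : T) (P : set T) (x : T) :
  P x -> xget x0 P = xget x1 P.
Proof. by rewrite /xget => Px; case: pselect => // -[]; exists x; apply/asboolP. Qed.

Section OpenSubgroups.
Local Open Scope group_scope.
Variable G : profiniteGroupType.
Implicit Types (A C D E : set G) (a b g h : G).

Lemma mulg_continuous2 (a b : G) : continuous (fun x : G => a * x * b).
Proof.
move=> x.
have mul2 (y z : G) (f : G -> G) (k : G -> G) : f @ x --> y -> k @ x --> z ->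
    (fun t => f t * k t) @ x --> y * z.
  move=> fy kz; apply: (@continuous2_cvg _ _ _ _ _ _ _ _ (fun u v : G => u * v)) fy kz.
  exact: (@profinite_mul_continuous G (y, z)).
by apply: (mul2 _ _ _ _); [apply: (mul2 _ _ _ _); [exact: cvg_cst|exact: cvg_id]|exact: cvg_cst].
Qed.

Lemma open_conjset g C : open C -> open (conjset g C).
Proof.
move=> oC; rewrite conjsetE; apply: (open_comp _ oC) => x _.
exact: mulg_continuous2.
Qed.

Lemma open_lmulset g C : open C -> open (lmulset g C).
Proof.
move=> oC; rewrite lmulsetE -[X in open X]/((fun x => g^-1 * x) @^-1` C).
apply: (open_comp _ oC) => x _; have := @mulg_continuous2 g^-1 1 x.
by rewrite /continuous_at mulg1; under eq_fun do rewrite mulg1.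
Qed.

Lemma open_Zint g V W : open V -> open W -> open (@Zint G g V W).
Proof. by move=> oV oW; apply: openI => //; apply: open_conjset. Qed.

(** The cosets are an open cover of a compact space; a finite subcover contains every coset, since
    distinct cosets are disjoint. *)
Lemma finite_lcosets_open (V : set G) : open V -> is_subgroup V -> finite_set (lcosets setT V).
Proof.
move=> oV sgV.
pose T : ptopologicalType := HB.pack_for ptopologicalType G (isPointed.Build G 1).
have := @profinite_compact G; rewrite -[compact _]/(@compact T setT) compact_cover.
move=> /(_ G setT (fun g => lmulset g V)) [].
- by move=> g _; apply: open_lmulset.
- by move=> g _; exists g => //; apply: lmulset_mem.
move=> D' _ cov; apply: (@sub_finite_set _ _ ((fun g => lmulset g V) @` [set` D'])).
  move=> _ [a _ <-]; have [b Db ba] := cov a I.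
  by exists b => //; apply/esym/lmulset_repr.
exact: finite_image.
Qed.

(** A group containing [U] is a union of cosets of [U], hence determined by a subset of the finite
    set [G/U]. *)
Lemma finite_overgroups (U : set G) : is_subgroup U -> finite_set (lcosets setT U) ->
  finite_set [set A | is_subgroup A /\ U `<=` A].
Proof.
move=> sgU Ufin; pose S := fset_set (lcosets setT U).
apply: (@sub_finite_set _ _ ((fun F : {fset set G} => \bigcup_(C in [set` F]) C)
    @` [set` fpowerset S])); last exact: finite_image.
move=> A [[A1 AM AV] UA]; have Afin := finite_lcosets A Ufin.
exists (fset_set (lcosets A U)).
  rewrite /= fpowersetE -fset_set_sub // => _ [a _ <-].
  by exists a.
rewrite fset_setK //; apply/seteqP; split=> [x [_ [a Aa <-] [u /UA Au <-]]|x Ax].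
  exact: AM.
by exists (lmulset x U); [exists x|exact: lmulset_mem].
Qed.

(** There are finitely many groups [B] containing [U], and each has finitely many conjugates. *)
Lemma finite_subconj (U : set G) : open U -> is_subgroup U ->
  finite_set [set A | is_subgroup A /\ subconj setT U A].
Proof.
move=> oU sgU; have Ufin := finite_lcosets_open oU sgU.
(* [K C] is [C C^-1], which is [a B a^-1] for [C = aB]; so the cosets of [B] enumerate its
   conjugates. *)
pose K C : set G := [set x | exists c d, [/\ C c, C d & x = c * d^-1]].
apply: (@sub_finite_set _ _ (\bigcup_(B in [set A | is_subgroup A /\ U `<=` A])
    (K @` lcosets setT B))); last first.
  apply: bigcup_finite => [|B [sgB UB]]; first exact: finite_overgroups.
  by apply: finite_image; apply: (finite_lcosetsS sgU).
move=> A [sgA [g _ UgA]]; have sgB := conjset_subgroup g sgA.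
exists (conjset g A) => //; exists (lmulset g^-1 (conjset g A)); first by exists g^-1.
rewrite -[RHS](conjsetK g); have [B1 BM BV] := sgB.
apply/seteqP; split=> [_ [_ [_ [[c Bc <-] [d Bd <-] ->]]]|_ [c Bc <-]].
  by exists (c * d^-1); rewrite ?(mulg_simp G) //; apply: BM => //; apply: BV.
by exists (g^-1 * c), g^-1; split; [exists c|exists 1; rewrite ?mulg1|].
Qed.

Variable H : set G.
Implicit Types U V W : opensub H.

Lemma opensub_inj : injective (@opensub_set G H).
Proof.
move=> [U oU sgU UH] [V oV sgV VH] /= UV; subst V.
by congr OpenSub; exact: Prop_irrelevance.
Qed.

Lemma ccl_val_inj : injective (@ccl_val G H).
Proof. by move=> [U hU] [V hV] /= UV; subst V; congr Ccl; exact: Prop_irrelevance. Qed.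

Lemma finite_opensub_subconj (U : set G) : open U -> is_subgroup U ->
  finite_set [set V : opensub H | subconj setT U V].
Proof.
move=> oU sgU; apply: (@sub_finite_set _ _ (@opensub_set G H @^-1`
    [set A | is_subgroup A /\ subconj setT U A])).
  by move=> V UV; split=> //; apply: opensub_subgroup.
apply: finite_preimage; last exact: finite_subconj.
by move=> V W _ _; apply: opensub_inj.
Qed.

Lemma subconjT (A B : set G) : subconj H A B -> subconj setT A B.
Proof. by move=> [g _ AB]; exists g. Qed.

(** The index sets of the primed sums are finite, so these sums can be split, exchanged and
    regrouped. *)
Lemma finite_ccl_subconj K (U : set G) : open U -> is_subgroup U ->
  finite_set [set V : ccl H | subconj K U V].
Proof.
move=> oU sgU; apply: (@sub_finite_set _ _ (@ccl_val G H @^-1`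
    [set V : opensub H | subconj setT U V])) => [V [g _ ?]|]; first by exists g.
apply: finite_preimage; last exact: finite_opensub_subconj.
by move=> V W _ _; apply: ccl_val_inj.
Qed.

Lemma opensub_lcosets U : finite_set (lcosets setT U).
Proof. by apply: finite_lcosets_open; [exact: opensub_open|exact: opensub_subgroup]. Qed.

Lemma conjugate_refl (A : set G) : H 1 -> conjugate H A A.
Proof. by exists 1; rewrite ?conjset1. Qed.

Hypothesis sgH : is_subgroup H.

Lemma conjugate_sym (A B : set G) : conjugate H A B -> conjugate H B A.
Proof.
have [_ _ HV] := sgH; move=> [g Hg ->]; exists g^-1; first exact: HV.
by rewrite conjsetK.
Qed.

Lemma conjugate_trans (B A C : set G) : conjugate H A B -> conjugate H B C -> conjugate H A C.
Proof.
have [_ HM _] := sgH; move=> [g Hg ->] [h Hh ->]; exists (g * h); first exact: HM.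
by rewrite conjsetM.
Qed.

Lemma subconj_conjl (A A' B : set G) : conjugate H A A' -> subconj H A' B -> subconj H A B.
Proof.
have [_ HM _] := sgH; move=> [g Hg ->] [h Hh AB]; exists (g * h); first exact: HM.
by rewrite conjsetM; apply: conjsetS.
Qed.

Lemma subconj_conjr (A B B' : set G) : conjugate H B B' -> subconj H A B -> subconj H A B'.
Proof.
have [_ HM _] := sgH; move=> [g Hg ->] [h Hh AB]; exists (h * g); first exact: HM.
by rewrite conjsetM.
Qed.

Lemma subconj_refl (A : set G) : subconj H A A.
Proof. by have [H1 _ _] := sgH; exists 1; rewrite ?conjset1. Qed.

Lemma subconj_trans (B A C : set G) : subconj H A B -> subconj H B C -> subconj H A C.
Proof.
have [_ HM _] := sgH; move=> [g Hg AB] [h Hh BC]; exists (g * h); first exact: HM.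
by apply: subset_trans AB _; rewrite conjsetM; apply: conjsetS.
Qed.

Lemma class_repr_conj U : conjugate H (class_repr U) U.
Proof.
rewrite /class_repr; apply: (@xgetPex _ _ [set V : opensub H | conjugate H V U]).
by exists U; apply: conjugate_refl; case: sgH.
Qed.

(** The two choices are made from the same class with different defaults, [U] and [V]; the class is
    inhabited, so they agree. *)
Lemma class_repr_eq U V : conjugate H U V -> class_repr U = class_repr V.
Proof.
move=> UV; have VU := conjugate_sym UV.
have E : [set W : opensub H | conjugate H W U] = [set W : opensub H | conjugate H W V].
  by apply/seteqP; split=> W /= /conjugate_trans; apply.
apply: etrans (congr1 (xget U) E) _.
by apply: (@xget_irr _ _ _ _ (class_repr V)); exact: class_repr_conj.
Qed.

End OpenSubgroups.

(** * Triangular systems of equations indexed by conjugacy classes *)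

Section Triangular.
Local Open Scope group_scope.
Variables (G : profiniteGroupType) (H : set G) (sgH : is_subgroup H).

Lemma class_repr_idem (U : opensub H) : class_repr (class_repr U) = class_repr U.
Proof. exact/class_repr_eq/class_repr_conj. Qed.

Definition mkccl (U : opensub H) : ccl H := Ccl (class_repr_idem U).

Lemma mkccl_conj (U : opensub H) : conjugate H (mkccl U) U.
Proof. exact: class_repr_conj. Qed.

Lemma conjugate_ccl (U V : ccl H) : conjugate H U V -> U = V.
Proof.
move=> /(class_repr_eq sgH) UV; apply: ccl_val_inj.
by rewrite -[LHS]ccl_repr -[RHS]ccl_repr.
Qed.

Lemma mkccl_eqP (U : opensub H) (V : ccl H) : mkccl U = V <-> conjugate H U V.
Proof.
split=> [<-|UV]; first exact: (conjugate_sym sgH (mkccl_conj U)).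
by apply: conjugate_ccl; exact: (conjugate_trans sgH (mkccl_conj U)).
Qed.

(** A conjugate of [V] contains [U] properly, and conjugation preserves the index. The index in [G]
    is the rank for the recursions below, for every [H]. *)
Lemma gindex_ccl_lt (U V : ccl H) : subconj H U V -> V <> U ->
  (gindex setT V < gindex setT U)%N.
Proof.
move=> [h Hh UV] VU; have sgV := opensub_subgroup V; have sgU := opensub_subgroup U.
rewrite -(@gindex_conj _ h setT V) //; apply: gindex_proper => //; last 1 first.
- exact: opensub_lcosets.
- exact: conjset_subgroup.
split=> // VU'; apply/VU/esym/conjugate_ccl; exists h => //.
exact/seteqP.
Qed.

Lemma finite_ccl_above (U : opensub H) : finite_set [set V : ccl H | subconj H U V].
Proof. exact: finite_ccl_subconj (opensub_open U) (opensub_subgroup U). Qed.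

Variables (R : zmodType) (X : Type) (c : ccl H -> ccl H -> X -> R).

Lemma fsbig_ccl_above (U : ccl H) (F : ccl H -> R) :
  (\sum_(V \in [set V : ccl H | subconj H U V]) F V
    = F U + \sum_(V \in [set V : ccl H | subconj H U V /\ V <> U]) F V)%R.
Proof.
rewrite (fsbigD1 U) //; [exact: finite_ccl_above|exact: subconj_refl].
Qed.

(** Induction on [(G:U)]: the off-diagonal terms involve only classes of smaller index. The entries
    [c U V] are arbitrary maps because the ghost equations are not linear. *)
Lemma triangular_inj (M N : ccl H -> X) :
  (forall U, injective (c U U)) ->
  (forall U : ccl H, \sum_(V \in [set V : ccl H | subconj H U V]) c U V (M V)
    = \sum_(V \in [set V : ccl H | subconj H U V]) c U V (N V))%R ->
  M = N.
Proof.
move=> cI MN.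
suff MNn n (U : ccl H) : (gindex setT U < n)%N -> M U = N U.
  by apply/funext => U; apply: MNn (ltnSn _).
elim: n U => // n IHn U; rewrite ltnS => leUn.
have := MN U; rewrite !fsbig_ccl_above.
rewrite (eq_fsbigr (fun V => c U V (N V))); first by move=> /addIr/cI.
move=> V /set_mem[UV VU]; rewrite IHn //.
exact: leq_trans (gindex_ccl_lt UV VU) leUn.
Qed.

Lemma triangular_surj (b : ccl H -> R) :
  (forall U y, exists x, c U U x = y) ->
  exists M : ccl H -> X,
    forall U : ccl H, (\sum_(V \in [set V : ccl H | subconj H U V]) c U V (M V) = b U)%R.
Proof.
move=> cS.
have [d dK] : exists d : ccl H -> R -> X, forall U y, c U U (d U y) = y.
  have /choice[d dK] : forall Uy : ccl H * R, exists x, c Uy.1 Uy.1 x = Uy.2.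
    by move=> Uy; exact: cS.
  by exists (fun U y => d (U, y)) => U y; rewrite (dK (U, y)).
(* One round solves each equation for its diagonal unknown, with the other unknowns read from
   [M]. *)
pose step (M : ccl H -> X) U :=
  d U (b U - \sum_(V \in [set V : ccl H | subconj H U V /\ V <> U]) c U V (M V))%R.
(* The start [d U 0] supplies an element of [X]. From stage [n] on, the values at classes of index
   below [n] are final. *)
pose M n := iter n step (d^~ 0%R).
have ME m n (U : ccl H) : (gindex setT U < m)%N -> (gindex setT U < n)%N -> M m U = M n U.
  elim: m n U => // m IHm [//|n] U; rewrite !ltnS => Um Un.
  rewrite /M /= -/(M m) -/(M n); congr (d U (_ - _)%R); apply: eq_fsbigr.
  move=> V /set_mem[UV VU]; have VltU := gindex_ccl_lt UV VU.
  by rewrite (IHm n) //; [exact: leq_trans VltU Um|exact: leq_trans VltU Un].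
exists (fun U : ccl H => M (gindex setT U).+1 U) => U.
have MS n U' : M n.+1 U' = step (M n) U' by [].
rewrite fsbig_ccl_above [X in c U U X]MS /step dK.
set S := (X in (_ - X + _)%R); set S' := (X in (_ + X)%R).
suff -> : S = S' by rewrite subrK.
apply: eq_fsbigr => V /set_mem[UV VU]; congr c; apply: ME => //.
exact: gindex_ccl_lt.
Qed.

End Triangular.

(** * Division by integers, and existence of the necklace coefficients [M_H(r,V)] *)

Lemma mulrn_ratI (R : comNzRingType) (q : {rmorphism rat -> R}) n :
  (0 < n)%N -> injective (fun x : R => x *+ n).
Proof.
move=> n0 x y /= xy; have qn : q (n%:R)^-1 * n%:R = 1.
  by rewrite -(rmorph_nat q n) -rmorphM mulVf ?rmorph1 // pnatr_eq0 -lt0n.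
rewrite -[x]mulr1 -[y]mulr1 -qn mulrCA [RHS]mulrCA.
by rewrite !mulr_natr xy.
Qed.

Lemma mulrn_rat_surj (R : comNzRingType) (q : {rmorphism rat -> R}) n (y : R) :
  (0 < n)%N -> exists x : R, x *+ n = y.
Proof.
move=> n0; exists (y * q (n%:R)^-1); rewrite -mulrnAr -mulr_natr.
by rewrite -(rmorph_nat q n) -rmorphM mulVf ?rmorph1 ?mulr1 // pnatr_eq0 -lt0n.
Qed.

Section Necklace.
Local Open Scope group_scope.
Variables (G : profiniteGroupType) (H : set G) (sgH : is_subgroup H).
Variables (R : comNzRingType) (q : {rmorphism rat -> R}).

Lemma mark_diag_gt0 (U : opensub H) : (0 < mark H U U)%N.
Proof.
apply/mark_gt0P; [exact: opensub_subgroup|exact: opensub_lcosets|].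
exact: subconj_refl.
Qed.

(** It suffices that some solution exists, since [necklace] chooses one; the system is triangular
    and its diagonal marks are invertible in [R]. *)
Lemma necklaceP (r : R) (U : opensub H) :
  (\sum_(V \in [set V : ccl H | subconj H U V]) necklace r V *+ mark H U V
    = r ^+ gindex H U)%R.
Proof.
suff [M MP] : exists M : ccl H -> R, forall U : opensub H,
    (\sum_(V \in [set V : ccl H | subconj H U V]) M V *+ mark H U V
    = r ^+ gindex H U)%R.
  by move: U; apply: (@xgetPex _ _ [set M : ccl H -> R | forall U : opensub H,
    (\sum_(V \in [set V : ccl H | subconj H U V]) M V *+ mark H U V
      = r ^+ gindex H U)%R]); exists M.
have [|M MP] := @triangular_surj G H sgH R R (fun U V x => x *+ mark H U V)%R
  (fun U => r ^+ gindex H U)%R.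
  by move=> V y; apply: mulrn_rat_surj => //; apply: mark_diag_gt0.
(* The equations hold for class representatives; both sides are invariant under [H]-conjugation of
   [U]. *)
exists M => {}U; have [h Hh UE] := mkccl_conj sgH U.
have E : [set V : ccl H | subconj H U V] = [set V : ccl H | subconj H (mkccl sgH U) V].
  apply/seteqP; split=> V /=; apply: subconj_conjl => //; first by exists h.
  by apply: conjugate_sym => //; exists h.
rewrite E -(@gindex_conj _ h H U) // -?UE; last exact: opensub_subgroup.
rewrite -MP; apply: eq_fsbigr => V _; rewrite UE mark_conjl //.
exact: opensub_subgroup.
Qed.

End Necklace.

(** * Products of marks, and indices up to conjugacy, for open subgroups *)

Section RationalBurnside.
Local Open Scope group_scope.
Variable G : profiniteGroupType.
Implicit Types U V W : opensub [set: G].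
Let T := [set: G].
Let sgT : is_subgroup T := subgroup_setT G.

Definition opensubT (H : set G) (V : opensub H) : opensub T :=
  OpenSub (opensub_open V) (opensub_subgroup V) (@subsetT _ V).

Definition Zint_opensub (g : G) V W : opensub T :=
  OpenSub (open_Zint g (opensub_open V) (opensub_open W))
    (Zint_subgroup g (opensub_subgroup V) (opensub_subgroup W)) (@subsetT _ _).

Lemma dcosetsE V W (X : set G) : dcosets V W X =
  [set D | double_cosets V W D /\ conjugate T (Zint (xget 1 D) V W) X].
Proof.
have sgV := opensub_subgroup V; have sgW := opensub_subgroup W.
apply/seteqP; split=> [D [g [DE ZX]]|D [/[dup] DE /(xget_dcoset sgV sgW) -> ZX]]; last first.
  by exists (xget 1 D); split=> //; move: ZX; rewrite -(xget_dcoset sgV sgW).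
have DC : double_cosets V W D by exists g.
split=> //; have : dcoset V g W (xget 1 D).
  by rewrite -DE {1}(xget_dcoset sgV sgW DC); apply: dcoset_mem.
move=> /(Zint_repr sgV sgW)[v _ ->]; apply: (conjugate_trans sgT) ZX.
by exists v.
Qed.

Lemma finite_dcosets V W (X : set G) : finite_set (dcosets V W X).
Proof.
rewrite dcosetsE; apply: sub_finite_set (finite_double_cosets V (opensub_lcosets W)).
by move=> D [].
Qed.

(** [Zint g V W] lies in both [V] and [g W g^-1]. This cuts the sums over all pairs of classes in
    the two products down to finite ones. *)
Lemma dcosets0 V W (X : set G) : ~ (subconj T X V /\ subconj T X W) ->
  dcosets V W X = set0.
Proof.
apply: contra_notP => /eqP/set0P[D [g [_ ZX]]].
have XZ := conjugate_sym sgT ZX.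
split; apply: (subconj_conjl sgT XZ).
  by exists 1; rewrite ?conjset1 // => x [].
by exists g => // x [].
Qed.

Lemma mark_conjugate U (V W : opensub T) : conjugate T V W ->
  mark T U V = mark T U W.
Proof. by move=> [g _ ->]; rewrite mark_conjr //; exact: opensub_subgroup. Qed.

Lemma gindex_conjugate U V : conjugate T U V -> gindex T U = gindex T V.
Proof. by move=> [g _ ->]; rewrite gindex_conj //; exact: opensub_subgroup. Qed.

Lemma gindexT_gt0 U : (0 < gindex T U)%N.
Proof. by apply: gindex_gt0 => //; [exact: opensub_subgroup|exact: opensub_lcosets]. Qed.

(** Group the double cosets in [mark_mul] by the conjugacy class of their [Zint]. *)
Lemma mark_dcoset_count U V W :
  (\sum_(X \in [set X : ccl T | subconj T U X]) (dcoset_count V W X * mark T U X)%N)%R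
    = (mark T U V * mark T U W)%N.
Proof.
have sgV := opensub_subgroup V; have sgW := opensub_subgroup W.
rewrite mark_mul //; try exact: opensub_lcosets.
pose Z D := Zint_opensub (xget 1 D) V W.
pose h D := mkccl sgT (Z D).
have DCfin := finite_double_cosets V (opensub_lcosets W).
rewrite (@fsumr_fibre _ _ _ _ (h @` double_cosets V W) h) //; last exact: finite_image.
(* Both sides are extended by zero to all classes [X]: on the left the mark vanishes off the classes
   above [U], on the right the fibre of [h] is empty. *)
rewrite (@fsbig_widen _ _ _ _ _ setT) //; last first.
  move=> X [_ /= UX]; rewrite (mark_eq0 _ _ UX) ?muln0 //; first exact: opensub_subgroup.
  exact: opensub_lcosets.
rewrite [RHS](@fsbig_widen _ _ _ _ _ setT) //; last first.
  move=> X [_ /= hX]; apply: fsbig1 => D [DC /= hD]; case: hX.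
  by exists D.
apply: eq_fsbigr => X _; rewrite /dcoset_count dcosetsE.
have -> : [set D | double_cosets V W D /\ conjugate T (Zint (xget 1 D) V W) X]
    = double_cosets V W `&` h @^-1` [set X].
  by apply/seteqP; split=> D [DC /(mkccl_eqP sgT (Z D) X)].
rewrite [RHS](eq_fsbigr (fun=> mark T U X)); last first.
  by move=> D /set_mem[_ /(mkccl_eqP sgT (Z D) X) /(@mark_conjugate U (Z D) X)].
rewrite fsumr_const; last exact: finite_setIl DCfin.
by rewrite -mulr_natl natn.
Qed.

(** Whichever conjugate of [V] is chosen, the index is [(G:U)] divided by [(G:V)], and the same
    holds for [g^-1 U g] inside [V]. *)
Lemma subconj_indexE (g : G) U V : U `<=` conjset g V ->
  subconj_index T V U = gindex V (conjset g^-1 U).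
Proof.
move=> UV; have sgU := opensub_subgroup U; have sgV := opensub_subgroup V.
rewrite /subconj_index; set V' := xget _ _.
have [[h _ V'E] UV'] : conjugate T V' V /\ U `<=` V'.
  apply: (@xgetPex _ _ [set V' | conjugate T V' V /\ U `<=` V']).
  by exists (conjset g V); split=> //; exists g.
have V0 := gindexT_gt0 V.
have EV' : gindex T U = (gindex T V * gindex V' U)%N.
  rewrite (@gindex_tower _ U V') //; last exact: opensub_lcosets.
    by rewrite V'E gindex_conj.
  by rewrite V'E; apply: conjset_subgroup.
have sgU' := conjset_subgroup g^-1 sgU.
have : gindex T (conjset g^-1 U) = gindex T U by rewrite gindex_conj.
rewrite (@gindex_tower _ _ V) //; last 2 first.
- by apply/conjset_subV.
- apply: finite_lcosets_open => //; apply: open_conjset; exact: opensub_open.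
by rewrite EV' => /eqP; rewrite eqn_pmul2l // => /eqP.
Qed.

Lemma gindexxx (U : set G) : is_subgroup U -> gindex U U = 1%N.
Proof.
move=> sgU; have [U1 UM UV] := sgU.
rewrite /gindex (_ : lcosets U U = [set U]) ?ncard1 //.
apply/seteqP; split=> [_ [a Ua <-]|_ ->] /=; last first.
  by exists 1; rewrite -?[LHS]/(lmulset 1 U) ?lmulset1.
rewrite -[RHS]lmulset1; apply/(lmulset_eqP _ _ sgU); rewrite mulg1; exact: UV.
Qed.

(** The diagonal term of a ghost sum is therefore linear in its unknown. *)
Lemma subconj_indexxx U : subconj_index T U U = 1%N.
Proof.
rewrite (@subconj_indexE 1) ?conjset1 // invg1 conjset1 gindexxx //.
exact: opensub_subgroup.
Qed.

Lemma subconj_index_gt0 U V : subconj T U V -> (0 < subconj_index T V U)%N.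
Proof.
move=> [g _ UV]; rewrite (subconj_indexE UV); apply: gindex_gt0.
- exact: opensub_subgroup.
- exact: conjset_subgroup (opensub_subgroup U).
- apply: finite_lcosets_open; first exact: open_conjset (opensub_open U).
  exact: conjset_subgroup (opensub_subgroup U).
Qed.

End RationalBurnside.

(** * Sums and integer multiples in rings *)

Lemma fsumrMnl (R : nmodType) (I : choiceType) (A : set I) (F : I -> R) n :
  finite_set A -> (\sum_(i \in A) F i) *+ n = \sum_(i \in A) F i *+ n.
Proof. by move=> Afin; rewrite !fsbig_finite // sumrMnl. Qed.

Lemma fsumrMnr (R : nmodType) (I : choiceType) (A : set I) (x : R) (F : I -> nat) :
  finite_set A -> x *+ (\sum_(i \in A) F i) = \sum_(i \in A) x *+ F i.
Proof. by move=> Afin; rewrite !fsbig_finite // sumrMnr. Qed.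

Lemma fsumr_distrlr (R : pzRingType) (I J : choiceType) (A : set I) (B : set J)
    (F : I -> R) (K : J -> R) : finite_set A -> finite_set B ->
  (\sum_(i \in A) F i) * (\sum_(j \in B) K j) = \sum_(p \in A `*` B) F p.1 * K p.2.
Proof.
move=> Afin Bfin; rewrite -(@pair_fsbig _ _ _ _ _ A B (fun i j => F i * K j)) //.
rewrite !fsbig_finite // big_distrl /=; apply: eq_bigr => i _.
by rewrite fsbig_finite // big_distrr.
Qed.

Lemma ratr_torsion_free (R : comNzRingType) (q : {rmorphism rat -> R}) :
  torsion_free R.
Proof.
by move=> n x xn; apply: (@mulrn_ratI _ q n.+1) => //=; rewrite mul0rn.
Qed.

Lemma torsion_free_mulrnI (R : comNzRingType) n :
  torsion_free R -> (0 < n)%N -> injective (fun x : R => x *+ n).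
Proof. by case: n => // n tfR _; apply: RatHull.mulrnI. Qed.

(** Used with [c] a coefficient of the product on [AP_G], [m = (G:V)], [n = (G:W)] and
    [k = (G:X)]. *)
Lemma ratr_mul_natmul (R : comNzRingType) (q : {rmorphism rat -> R}) (c : rat)
    (a b : R) m n k :
  c * (m%:R * n%:R) = k%:R -> q c * (a *+ m) * (b *+ n) = a * b *+ k.
Proof.
move=> ck; rewrite -[a *+ m]mulr_natl -[b *+ n]mulr_natl -[RHS]mulr_natl.
by rewrite -!(rmorph_nat q) -ck !rmorphM /=; ring.
Qed.

Lemma classmap_eq (G : profiniteGroupType) (A : Type) (x y : classmap G A) :
  (forall U, x U = y U) -> x = y.
Proof.
move: x y => [x xP] [y yP] /= xy; have E : x = y by apply/funext.
by subst y; congr ClassMap; exact: Prop_irrelevance.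
Qed.

(** * Marks on [Delta_G(R)], the ghost maps, and the bijections [tau] and [theta] *)

Section Marks.
Variables (G : profiniteGroupType) (R : comNzRingType).
Implicit Types U V W : opensub [set: G].
Let T := [set: G].
Let sgT : is_subgroup T := subgroup_setT G.
Implicit Types x y : ccl T -> R.

Definition above U : set (ccl T) := [set V : ccl T | subconj T U V].

(* The ring homomorphism [Delta_G(R) -> R] through which the ghost map factors. *)
Definition mark_hom U x : R := \sum_(V \in above U) x V *+ mark T U V.

Lemma finite_above U : finite_set (above U).
Proof. exact: finite_ccl_above. Qed.

Lemma mark_hom_add U x y :
  mark_hom U (pointwise_add x y) = mark_hom U x + mark_hom U y.
Proof.
rewrite /mark_hom -fsbig_split; last exact: finite_above.
by apply: eq_fsbigr => V _; rewrite mulrnDl.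
Qed.

(** A pair contributes at [X] only if both members are above [X], hence above [U]. The index set
    becomes finite and independent of [X]. *)
Lemma Delta_mulE U (X : ccl T) x y : above U X -> Delta_mul x y X =
  \sum_(P \in above U `*` above U) x P.1 * y P.2 *+ dcoset_count P.1 P.2 X.
Proof.
move=> UX; apply/esym/fsbig_widen => // -[V W] [_ /= nUVW].
rewrite /dcoset_count dcosets0 ?ncard0 // => -[XV XW]; apply: nUVW.
by split; apply: subconj_trans UX _.
Qed.

(** The coefficient of [x_V y_W] on the left is the sum evaluated by [mark_dcoset_count]. *)
Lemma mark_hom_mul U x y :
  mark_hom U (Delta_mul x y) = mark_hom U x * mark_hom U y.
Proof.
have Sfin := finite_above U; have SSfin := finite_setX Sfin Sfin.
rewrite fsumr_distrlr //.
rewrite /mark_hom (eq_fsbigr (fun X : ccl T => \sum_(P \in above U `*` above U)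
    x P.1 * y P.2 *+ (dcoset_count P.1 P.2 X * mark T U X)%N)); last first.
  move=> X /set_mem UX; rewrite (Delta_mulE _ _ UX) fsumrMnl //.
  by apply: eq_fsbigr => P _; rewrite mulrnA.
rewrite exchange_fsbig //; apply: eq_fsbigr => P _.
rewrite -fsumrMnr // (mark_dcoset_count U P.1 P.2).
by rewrite mulrnA -mulrnAl -mulrnAr.
Qed.

Lemma mark_hom_inj x y : torsion_free R ->
  (forall U, mark_hom U x = mark_hom U y) -> x = y.
Proof.
move=> tfR xy; apply: (@triangular_inj G T sgT R R (fun (U V : ccl T) a => a *+ mark T U V) x y).
  by move=> U; apply: torsion_free_mulrnI => //; apply: mark_diag_gt0.
by move=> U; exact: xy.
Qed.

(** The ghost equations are triangular with diagonal [a *+ mark T U U], injective without torsion.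
    The lemma serves rings containing the rationals and also the integers. *)
Lemma ghost_inj (alpha beta : classmap G R) : torsion_free R ->
  (forall U, ghost U alpha = ghost U beta) -> alpha = beta.
Proof.
move=> tfR ab; apply: classmap_eq => U.
have <- := classmapP alpha (mkccl_conj sgT U).
have <- := classmapP beta (mkccl_conj sgT U).
suff /(congr1 (@^~ (mkccl sgT U))) : (fun V : ccl T => alpha V) = (fun V : ccl T => beta V) by [].
apply: (@triangular_inj G T sgT R R (fun (U V : ccl T) a => a ^+ subconj_index T V U *+ mark T U V)
  (fun V : ccl T => alpha V) (fun V : ccl T => beta V)); last by move=> V; exact: ab.
move=> V a b; rewrite subconj_indexxx !expr1.
by apply: torsion_free_mulrnI => //; apply: mark_diag_gt0.
Qed.

Variable q : {rmorphism rat -> R}.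

Lemma ghost_surj (b : ccl T -> R) :
  exists alpha : classmap G R, forall U : ccl T, ghost U alpha = b U.
Proof.
have [|M MP] := @triangular_surj G T sgT R R
  (fun (U V : ccl T) a => a ^+ subconj_index T V U *+ mark T U V) b.
  move=> V y; rewrite subconj_indexxx; have [a <-] := mulrn_rat_surj q y (mark_diag_gt0 sgT V).
  by exists a.
(* The solution lives on class representatives; composing with [mkccl] extends it to all open
   subgroups. *)
have aP U V : conjugate setT U V -> M (mkccl sgT U) = M (mkccl sgT V).
  move=> UV; congr M; apply/mkccl_eqP; apply: (conjugate_trans sgT UV).
  exact: conjugate_sym (mkccl_conj sgT V).
exists (ClassMap aP) => U; rewrite -MP; apply: eq_fsbigr => V _ /=.
by congr (M _ ^+ _ *+ _); apply/mkccl_eqP/conjugate_refl.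
Qed.

(** Group the [H]-classes by their [G]-class, on which the mark at [U] is constant. *)
Lemma mark_hom_Ind U (H : opensub T) (x : ccl H -> R) :
  mark_hom U (Ind x) = \sum_(V \in [set V : ccl H | subconj T U V]) x V *+ mark T U V.
Proof.
have Afin : finite_set [set V : ccl H | subconj T U V].
  exact: finite_ccl_subconj (opensub_open U) (opensub_subgroup U).
rewrite (@fsumr_fibre _ _ _ _ (above U) (fun V : ccl H => mkccl sgT (opensubT V))) //; last 2 first.
- exact: finite_above.
- move=> V /= UV; apply: subconj_conjr UV => //.
  exact: (conjugate_sym sgT (mkccl_conj sgT (opensubT V))).
apply: eq_fsbigr => W /set_mem UW; rewrite /Ind.
have -> : [set V : ccl H | conjugate T V W] = [set V : ccl H | subconj T U V]
    `&` (fun V : ccl H => mkccl sgT (opensubT V)) @^-1` [set W].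
  apply/seteqP; split=> [V /= VW|V [_ /(mkccl_eqP sgT (opensubT V) W)]//].
  split; last exact/(mkccl_eqP sgT (opensubT V) W).
  by apply: subconj_conjr UW => //; apply: conjugate_sym.
rewrite fsumrMnl; last exact: finite_setIl.
apply: eq_fsbigr => V /set_mem[_ /(mkccl_eqP sgT (opensubT V) W) VW].
by rewrite (@mark_conjugate _ U (opensubT V) W).
Qed.

(** By [mark_tower] the sum splits over the fixed points [gH] of [U], and the defining equation of
    [necklace] at [g^-1 U g] turns each part into the same power of [r]. *)
Lemma mark_hom_necklace U (H : opensub T) (r : R) :
  mark_hom U (Ind (@necklace G R H r)) = r ^+ subconj_index T H U *+ mark T U H.
Proof.
have sgH := opensub_subgroup H; have sgU := opensub_subgroup U.
have Hfin := opensub_lcosets H.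
have Ffin : finite_set (fixcosets T U H) by exact: finite_fixcosets.
have Afin : finite_set [set V : ccl H | subconj T U V].
  exact: finite_ccl_subconj (opensub_open U) sgU.
rewrite mark_hom_Ind.
rewrite (eq_fsbigr (fun V : ccl H => \sum_(C \in fixcosets T U H)
    necklace r V *+ mark H (conjset (xget 1%g C)^-1%g U) V)); last first.
  move=> V _; rewrite -fsumrMnr //; congr (_ *+ _).
  exact: mark_tower (opensub_subgroup V) sgH (@opensub_sub _ _ V) (opensub_lcosets V).
rewrite exchange_fsbig // markE -fsumr_const //.
apply: eq_fsbigr => C /set_mem CF; set g := xget 1%g C.
have UgH : U `<=` conjset g H.
  have [/(xget_lcoset sgH) gC _] := CF.
  have [a [_ aC UaH]] := (fixcosetsP T U C sgH).1 CF.
  apply: subset_trans UaH _; rewrite -(conjsetVK g (conjset a H)) -(conjsetM g^-1%g).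
  apply: conjsetS; apply: (conjset_subid sgH) => //.
  by apply/(lmulset_eqP _ _ sgH); rewrite gC aC.
pose U' := @OpenSub G H (conjset g^-1%g U) (open_conjset g^-1%g (opensub_open U))
  (conjset_subgroup g^-1%g sgU) ((conjset_subV g U H).2 UgH).
rewrite (subconj_indexE UgH) -(necklaceP sgH q r U').
(* The extra classes [V] are not above [U'] in [H], so their marks at [U'] vanish. *)
apply/esym/fsbig_widen => [V|V [_ /= U'V]].
  move=> /subconjT; apply: subconj_conjl => //; exists g => //=.
  by rewrite conjsetVK.
by rewrite (mark_eq0 _ _ U'V) ?mulr0n //; [exact: opensub_subgroup|exact: opensub_lcosets].
Qed.

Lemma mark_hom_tau U (alpha : classmap G R) : mark_hom U (tauQ alpha) = ghost U alpha.
Proof.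
have Sfin := finite_above U.
rewrite /ghost -/(above U) [RHS](eq_fsbigr
  (fun H : ccl T => mark_hom U (Ind (@necklace G R H (alpha H))))); last first.
  by move=> H _; rewrite mark_hom_necklace.
rewrite /mark_hom exchange_fsbig //; apply: eq_fsbigr => W /set_mem UW.
(* At a class [W] above [U], induction from [H] gives 0 unless [W] is conjugate to a subgroup of
   [H]; so only [H] above [U] count. *)
rewrite -fsumrMnl //; congr (_ *+ _); apply/esym/fsbig_widen => // H [_ /= UH].
rewrite /Ind (_ : [set V : ccl H | conjugate T V W] = set0) ?fsbig_set0 //.
apply/seteqP; split=> // V /= VW; apply: UH.
have UV := subconj_conjr sgT (conjugate_sym sgT VW) UW.
apply: (subconj_trans sgT UV); exists 1%g => //.
by rewrite conjset1; exact: opensub_sub.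
Qed.

Lemma tauQ_inj : injective (@tauQ G R).
Proof.
have tfR := ratr_torsion_free q.
move=> alpha beta ab; apply: ghost_inj => // U.
by rewrite -!mark_hom_tau ab.
Qed.

(** Choose [alpha] whose ghost components are the marks of [x]; marks determine an element. *)
Lemma tauQ_surj (x : ccl T -> R) : exists alpha, tauQ alpha = x.
Proof.
have tfR := ratr_torsion_free q.
have [alpha alphaP] := ghost_surj (fun U : ccl T => mark_hom U x).
exists alpha; apply: (@triangular_inj G T sgT R R (fun (U V : ccl T) a => a *+ mark T U V) _ x).
  by move=> U; apply: torsion_free_mulrnI => //; apply: mark_diag_gt0.
by move=> U; have := alphaP U; rewrite -mark_hom_tau.
Qed.

Lemma thetaQ_inj : injective (@thetaQ G R).
Proof.
move=> x y xy; apply/funext => U; have := congr1 (@^~ U) xy.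
by apply: mulrn_ratI => //; apply: gindexT_gt0.
Qed.

Lemma thetaQ_surj (y : ccl T -> R) : exists x, thetaQ x = y.
Proof.
have /choice[x xP] (U : ccl T) : exists a, a *+ gindex T U = y U.
  by apply: mulrn_rat_surj => //; apply: gindexT_gt0.
by exists x; apply/funext => U; apply: xP.
Qed.

Lemma thetaQ_add x y :
  thetaQ (pointwise_add x y) = pointwise_add (thetaQ x) (thetaQ y).
Proof. by apply/funext => U; rewrite /thetaQ /pointwise_add mulrnDl. Qed.

Lemma dcoset_coefE V W (X : opensub T) (D : set G) : dcosets V W X D ->
  dcoset_coef V W (xget 1%g D)
    = (gindex T X)%:R / ((gindex T V)%:R * (gindex T W)%:R).
Proof.
rewrite dcosetsE => -[_ ZX]; rewrite /dcoset_coef.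
by rewrite (@gindex_conjugate _ (Zint_opensub (xget 1%g D) V W) X).
Qed.

(** On the double cosets contributing at [X] the coefficient is [(G:X)/((G:V)(G:W))]; the rescaling
    of both factors cancels its denominator. *)
Lemma thetaQ_mul x y : thetaQ (Delta_mul x y) = AP_mul q (thetaQ x) (thetaQ y).
Proof.
apply/funext => X; have Sfin := finite_above X; have SSfin := finite_setX Sfin Sfin.
rewrite /thetaQ (@Delta_mulE X X); last exact: subconj_refl.
rewrite fsumrMnl //.
rewrite /AP_mul (@fsbig_widen _ _ _ _ (above X `*` above X) setT) //.
  apply: eq_fsbigr => -[V W] _ /=.
  rewrite (eq_fsbigr (fun=> x V * y W *+ gindex T X)).
    by rewrite fsumr_const; [rewrite mulrnAC|exact: finite_dcosets].
  move=> D /set_mem/dcoset_coefE ->.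
  apply: ratr_mul_natmul; rewrite mulfVK // mulf_neq0 // pnatr_eq0 -lt0n;
    exact: gindexT_gt0.
by move=> [V W] [_ nXVW] /=; rewrite /dcoset_count dcosets0 ?ncard0 ?mul0rn //.
Qed.

End Marks.

(** * Arithmetic in [W_G(A)] *)

Section WittBurnsideRing.
Variables (G : profiniteGroupType) (W : wittBurnside G).

Lemma comp_classmap_inj (A B : Type) (f : A -> B) :
  injective f -> injective (@comp_classmap G A B f).
Proof.
move=> fI x y xy; apply: classmap_eq => U; apply: fI.
exact: (congr1 (fun z : classmap G B => z U) xy).
Qed.

(** [W_G(A)] is only a set with two operations; ring calculations are made in [R] and moved along
    [e]. *)
Lemma W_ringE (A : comNzRingType) : exists (R : comNzRingType) (e : R -> classmap G A),
  [/\ injective e, forall x, exists r, e r = x,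
      {morph e : a b / a + b >-> W_add W a b} & {morph e : a b / a * b >-> W_mul W a b}].
Proof.
have [+ _ _ _] := W_is_functor W; move=> /(_ A)[R [e [eI eT eD eM]]].
exists R, e; split=> // x; have : [set: classmap G A] x by [].
by rewrite -[X in X x]/(@pr_dom (W A)) -eT => -[r _ <-]; exists r.
Qed.

Lemma W_mor (A B : comNzRingType) (f : {rmorphism A -> B}) :
  is_ringhom (comp_classmap f : W A -> W B).
Proof. by have [_ + _ _] := W_is_functor W; apply. Qed.

Lemma comp_W_add (A B : comNzRingType) (f : {rmorphism A -> B}) (x y : classmap G A) :
  comp_classmap f (W_add W x y) = W_add W (comp_classmap f x) (comp_classmap f y).
Proof. by have [_ + _ _] := W_mor f; apply. Qed.

Lemma comp_W_mul (A B : comNzRingType) (f : {rmorphism A -> B}) (x y : classmap G A) :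
  comp_classmap f (W_mul W x y) = W_mul W (comp_classmap f x) (comp_classmap f y).
Proof. by have [_ _ + _] := W_mor f; apply. Qed.

Lemma ghost_add (A : comNzRingType) U (x y : classmap G A) :
  ghost U (W_add W x y) = ghost U x + ghost U y.
Proof. by have [_ + _ _] := W_ghost W A U; apply. Qed.

Lemma ghost_mul (A : comNzRingType) U (x y : classmap G A) :
  ghost U (W_mul W x y) = ghost U x * ghost U y.
Proof. by have [_ _ + _] := W_ghost W A U; apply. Qed.

Lemma W_addA (A : comNzRingType) : associative (@W_add G W A).
Proof.
have [R [e [_ eT eD _]]] := W_ringE A; move=> x y z.
by have [[[a <-] [b <-]] [c <-]] := (eT x, eT y, eT z); rewrite -!eD addrA.
Qed.

Lemma int_torsion_free : torsion_free int.
Proof. by move=> n x /eqP; rewrite mulrn_eq0 /= => /eqP. Qed.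

(* By functoriality it suffices that [0 + 0 = 0] in [W_G(Z)], where the ghost
   maps are jointly injective. *)
Lemma W_add0 (A : comNzRingType) (x : classmap G A) : W_add W x (const_classmap G 0) = x.
Proof.
have ghost0 (U : opensub [set: G]) : ghost U (const_classmap G (0 : int)) = 0.
  apply: fsbig1 => V /= UV; rewrite expr0n.
  by have := subconj_index_gt0 UV; case: (subconj_index _ _ _) => // n _; rewrite mul0rn.
have D0 : W_add W (const_classmap G (0 : int)) (const_classmap G 0) = const_classmap G 0.
  by apply: (ghost_inj int_torsion_free) => U; rewrite ghost_add !ghost0 addr0.
pose iota : {rmorphism int -> A} := intr.
have := comp_W_add iota (const_classmap G (0 : int)) (const_classmap G 0); rewrite D0.
have -> : comp_classmap iota (const_classmap G (0 : int)) = const_classmap G 0.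
  by apply: classmap_eq => U /=.
have [R [e [eI eT eD _]]] := W_ringE A.
have [[a <-] [z <-]] := (eT x, eT (const_classmap G 0)).
(* The image of [D0] says [z + z = z], hence [z = 0]. *)
by rewrite -!eD => /eI/eqP; rewrite addrC -subr_eq subrr => /eqP <-; rewrite addr0.
Qed.

(** Take [i = y - x] and cancel the image of [x]: maps with the same image differ by an element of
    [W_G(ker f)]. *)
Lemma W_fibre (A B : comNzRingType) (f : {rmorphism A -> B}) (x y : classmap G A) :
  comp_classmap f x = comp_classmap f y ->
  exists2 i, comp_classmap f i = const_classmap G 0 & y = W_add W x i.
Proof.
have [R [e [_ eT eD _]]] := W_ringE A.
have [[a <-] [b <-]] := (eT x, eT y) => fab.
exists (e (b - a)); last by rewrite -eD addrC subrK.
have [S [e' [eI' eT' eD' _]]] := W_ringE B.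
move: (comp_W_add f (e a) (e (b - a))); rewrite -eD addrC subrK -fab.
rewrite -{1}(W_add0 (comp_classmap f (e a))).
have [[[z <-] [c <-]] [d <-]] := (eT' (const_classmap G 0),
  eT' (comp_classmap f (e a)), eT' (comp_classmap f (e (b - a)))).
by rewrite -!eD' => /eI'/addrI ->.
Qed.

End WittBurnsideRing.

(** * Rings and functors identified with [W_G] *)

Section Coordinates.
Variables (G : profiniteGroupType) (W : wittBurnside G).

(** A ring isomorphism from [W_G(A)] onto the carrier of [X]; compatibility with units follows in
    [coordinates_one]. *)
Definition coordinates (A : comNzRingType) (X : preRing) (s : classmap G A -> X) : Prop :=
  [/\ injective s, range s = @pr_dom X,
      {morph s : a b / W_add W a b >-> pr_add a b}
    & {morph s : a b / W_mul W a b >-> pr_mul a b}].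

Lemma coordinates_one (A : comNzRingType) (X : preRing) (s : classmap G A -> X) a : coordinates s ->
  is_one (s a) <-> @is_one (W A) a.
Proof.
move=> [sI sT _ sM]; split=> -[_ e1]; split=> //.
- by move=> b _; apply: sI; rewrite sM e1 // -sT; exists b.
- by rewrite -sT; exists a.
- by move=> y; rewrite -sT => -[b _ <-]; rewrite -sM; congr s; exact: e1.
Qed.

Lemma coordinates_comring (A : comNzRingType) (X : preRing) (s : classmap G A -> X) :
  coordinates s -> is_comring X.
Proof.
move=> [sI sT sD sM]; have [R [e [eI eT eD eM]]] := W_ringE W A.
exists R, (s \o e); split=> //=; first exact: inj_comp.
- rewrite -sT; apply/seteqP; split=> [_ [r _ <-]|_ [a _ <-]]; first by exists (e r).
  by have [r <-] := eT a; exists r.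
- by move=> a b /=; rewrite eD sD.
- by move=> a b /=; rewrite eM sM.
Qed.

(** An injective [f] embeds [W_G(A)] in [W_G(B)], so [s] identifies it with a subring of [X]; this
    is the torsion-free case. *)
Lemma coordinates_comp (A B : comNzRingType) (X : preRing) (f : {rmorphism A -> B})
    (s : classmap G B -> X) :
  injective f -> coordinates s ->
  @coordinates A (sub_ring (range (s \o comp_classmap f))) (s \o comp_classmap f).
Proof.
move=> fI [sI sT sD sM]; split=> //=; first exact: inj_comp (comp_classmap_inj fI).
  by move=> a b /=; rewrite comp_W_add sD.
by move=> a b /=; rewrite comp_W_mul sM.
Qed.

(** A natural isomorphism from [W_G] to [F], phrased before [F] is known to be a functor so that the
    functor laws can be carried over. *)
Definition functor_coordinates (F : preFunctor)
    (s : forall A : comNzRingType, classmap G A -> F A) : Prop :=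
  (forall A, coordinates (s A)) /\
  forall (A B : comNzRingType) (f : {rmorphism A -> B}) a,
    fmor F f (s A a) = s B (comp_classmap f a).

Lemma functor_coordinates_W : functor_coordinates (F := W) (fun A => @id (classmap G A)).
Proof. by split=> // A; split=> //; apply/seteqP; split=> // a _; exists a. Qed.

Lemma functor_coordinates_functor F s : @functor_coordinates F s -> is_functor F.
Proof.
move=> [sP sN]; have sT A x : @pr_dom (F A) x -> exists a, s A a = x.
  by have [_ <- _ _] := sP A; move=> [a _ <-]; exists a.
have [_ WH WI WC] := W_is_functor W.
split=> [A|A B f|A x /sT[a <-]|A B C f g x /sT[a <-]].
- exact: coordinates_comring (sP A).
- have [_ sBT sBD sBM] := sP B; have [_ _ sAD sAM] := sP A.
  split=> [x /sT[a <-]|x y /sT[a <-] /sT[b <-]|x y /sT[a <-] /sT[b <-]|x].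
  + by rewrite sN -sBT; eexists.
  + by rewrite -sAD !sN comp_W_add sBD.
  + by rewrite -sAM !sN comp_W_mul sBM.
  + move=> /[dup] -[/sT[a <-] _] /(coordinates_one _ (sP A)) a1.
    rewrite sN; apply/(coordinates_one _ (sP B)).
    by have [_ _ _] := WH A B f; apply.
- by rewrite sN; congr s; apply: classmap_eq.
- by rewrite !sN; congr s; apply: classmap_eq.
Qed.

Lemma functor_coordinates_iso F F' s t :
  @functor_coordinates F s -> @functor_coordinates F' t -> naturally_isomorphic F F'.
Proof.
move=> [sP sN] [tP tN].
(* This is [t] after the inverse of [s]; the default is taken only outside the carrier of [F A]. *)
pose eta A (x : F A) := t A (xget (const_classmap G 0) [set a | s A a = x]).
have etaE A a : eta A (s A a) = t A a.
  have [sI _ _ _] := sP A; congr t; apply: xget_unique => // b /sI.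
  exact.
have sT A x : @pr_dom (F A) x -> exists a, s A a = x.
  by have [_ <- _ _] := sP A; move=> [a _ <-]; exists a.
exists eta; split=> [A|A|A B f x /sT[a <-]]; last by rewrite sN !etaE tN.
- have [sI sA sD sM] := sP A; have [tI tA tD tM] := tP A.
  split=> [x /sT[a <-]|x y /sT[a <-] /sT[b <-]|x y /sT[a <-] /sT[b <-]|x].
  + by rewrite etaE -tA; exists a.
  + by rewrite -sD !etaE tD.
  + by rewrite -sM !etaE tM.
  + move=> /[dup] -[/sT[a <-] _] /(coordinates_one _ (sP A)) a1.
    by rewrite etaE; apply/(coordinates_one _ (tP A)).
- have [sI sA _ _] := sP A; have [tI tA _ _] := tP A; split.
  + by move=> x /sT[a <-]; rewrite etaE -tA; exists a.
  + move=> x y /set_mem/sT[a <-] /set_mem/sT[b <-].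
    by rewrite !etaE => /tI ->.
  + move=> y; rewrite -tA => -[a _ <-]; exists (s A a); last exact: etaE.
    by rewrite -sA; exists a.
Qed.

Lemma transportE (A B : comNzRingType) (X Y : Type) (s : classmap G A -> X)
    (t : classmap G B -> Y) (f : A -> B) a :
  injective s -> transport s t f (s a) = t (comp_classmap f a).
Proof.
move=> sI; rewrite /transport; congr (t (comp_classmap f _)).
by apply: xget_unique => // b /sI.
Qed.

(** * The quotient by the image of [W_G(ker f)] *)

Section Quotient.
Variables (A B : comNzRingType) (f : {rmorphism A -> B}).
Hypothesis fS : forall b, exists a, f a = b.
Variables (X : preRing) (s : classmap G A -> X) (sP : coordinates s).

Definition lifts (y : classmap G B) : set (classmap G A) :=
  [set x | forall U, f (x U) = y U].

Lemma liftsE y : lifts y = [set x | comp_classmap f x = y].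
Proof.
apply/seteqP; split=> x /= xy; first exact: classmap_eq.
by move=> U; rewrite -xy.
Qed.

(** This is [Delta_ker] for [s = tau], and [AP_ker] for [s = theta \o tau]. *)
Definition ker_image : set X := s @` [set x : classmap G A | forall U, f (x U) = 0].

Lemma ker_imageE : ker_image = s @` lifts (const_classmap G 0).
Proof. by []. Qed.

(** A set-theoretic section of [f], applied value by value, keeps a map constant on conjugacy
    classes. *)
Lemma lifts_neq0 y : exists x, lifts y x.
Proof.
have [g gK] := choice fS.
by exists (comp_classmap g y) => U /=; rewrite gK.
Qed.

(** Adding an element of the kernel preserves the image under [f], and by [W_fibre] every lift
    arises so. Cosets are thus the images of fibres, free of representatives. *)
Lemma coset_ofE x : coset_of ker_image (s x) = s @` lifts (comp_classmap f x).
Proof.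
have [sI sT sD _] := sP; rewrite ker_imageE !liftsE.
apply/seteqP; split=> [_ [_ [i /= i0 <-] <-]|_ [y /= yx <-]].
  by rewrite -sD; exists (W_add W x i) => //=; rewrite comp_W_add i0 W_add0.
have [i i0 ->] := W_fibre W (esym yx).
by exists (s i); [exists i|rewrite sD].
Qed.

Lemma coordinates_quotient :
  @coordinates B (quotient_ring ker_image) (fun y => s @` lifts y).
Proof.
have [sI sT sD sM] := sP.
split=> [y z yz|||].
- have [x xy] := lifts_neq0 y.
  have : (s @` lifts z) (s x) by rewrite -yz; exists x.
  move=> [x' x'z /sI xx']; apply: classmap_eq => U.
  by rewrite -xy -x'z xx'.
- apply/seteqP; split=> [_ [y _ <-]|_ [x + <-]].
    have [x] := lifts_neq0 y; rewrite {1}liftsE /= => xy.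
    by exists (s x); [rewrite -sT; exists x|rewrite coset_ofE xy].
  by rewrite -sT => -[a _ <-]; rewrite coset_ofE; eexists.
- move=> y z; rewrite !liftsE /=; apply/seteqP; split=> [_ [c /= cyz <-]|].
    have [a] := lifts_neq0 y; have [b] := lifts_neq0 z; rewrite !liftsE /= => bz ay.
    have [|i i0 ->] := @W_fibre _ W _ _ f (W_add W a b) c.
      by rewrite comp_W_add ay bz.
    (* The kernel element [i] is absorbed into the lift of [z]. *)
    exists (s a), (s (W_add W b i)); split; [by exists a| |by rewrite -W_addA sD].
    by exists (W_add W b i) => //=; rewrite comp_W_add i0 W_add0.
  move=> _ [_ [_ [[a /= ay <-] [b /= bz <-] ->]]].
  by exists (W_add W a b); rewrite //= comp_W_add ay bz.
- move=> y z; rewrite !liftsE /=; apply/seteqP; split=> [_ [c /= cyz <-]|].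
    have [a] := lifts_neq0 y; have [b] := lifts_neq0 z; rewrite !liftsE /= => bz ay.
    have [|i i0 ->] := @W_fibre _ W _ _ f (W_mul W a b) c.
      by rewrite comp_W_mul ay bz.
    exists (s a), (s b), (s i); split; [by exists a|by exists b| |by rewrite sD sM].
    by rewrite ker_imageE liftsE; exists i.
  move=> _ [_ [_ [k [[a /= ay <-] [b /= bz <-] Ik ->]]]].
  move: Ik; rewrite ker_imageE liftsE => -[i /= i0 <-].
  exists (W_add W (W_mul W a b) i); last by rewrite sD sM.
  by rewrite /= comp_W_add comp_W_mul ay bz i0 W_add0.
Qed.

End Quotient.

(** * The three cases in the construction of [Delta_G] and [AP_G] *)

Definition model_coordinates (A : comNzRingType) (M : model G A) : Prop :=
  coordinates (tau M) /\ coordinates (@theta _ _ M \o tau M).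

(** Identities in [Delta_G(A)] are tested on marks, where [mark_hom_tau] reduces them to the ghost
    maps being ring homomorphisms. *)
Lemma rational_model_coordinates (A : comNzRingType) (q : {rmorphism rat -> A}) :
  model_coordinates (rational_model G q).
Proof.
have tfA := ratr_torsion_free q.
split; split=> /=.
- exact: tauQ_inj q.
- by apply/seteqP; split=> // x _; have [a <-] := tauQ_surj q x; exists a.
- move=> a b; apply: (mark_hom_inj tfA) => U.
  by rewrite mark_hom_add !(mark_hom_tau q) ghost_add.
- move=> a b; apply: (mark_hom_inj tfA) => U.
  by rewrite mark_hom_mul !(mark_hom_tau q) ghost_mul.
- by apply: inj_comp; [exact: thetaQ_inj q|exact: tauQ_inj q].
- apply/seteqP; split=> // y _; have [x <-] := thetaQ_surj q y.
  by have [a <-] := tauQ_surj q x; exists a.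
- move=> a b /=; rewrite -thetaQ_add; congr thetaQ; apply: (mark_hom_inj tfA) => U.
  by rewrite mark_hom_add !(mark_hom_tau q) ghost_add.
- move=> a b /=; rewrite -(thetaQ_mul q); congr thetaQ; apply: (mark_hom_inj tfA) => U.
  by rewrite mark_hom_mul !(mark_hom_tau q) ghost_mul.
Qed.

Lemma ratHull_incl_inj (A : comNzRingType) (tfA : torsion_free A) :
  injective (ratHull_incl tfA).
Proof. by move=> a b /RatHull.fracP/eqP; rewrite !mulr1n. Qed.

Lemma integral_model_coordinates (A : comNzRingType) (tfA : torsion_free A) :
  model_coordinates (integral_model G tfA).
Proof.
have [tauP thetaP] := rational_model_coordinates (ratHull_rat tfA).
split; first exact: (coordinates_comp (@ratHull_incl_inj A tfA) tauP).
have := coordinates_comp (@ratHull_incl_inj A tfA) thetaP.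
by rewrite /integral_model /= image_comp.
Qed.

Lemma torsion_free_model_coordinates (A : comNzRingType) (tfA : torsion_free A) :
  model_coordinates (torsion_free_model G tfA).
Proof.
rewrite /torsion_free_model; case: pselect => h.
  exact: rational_model_coordinates.
exact: integral_model_coordinates.
Qed.

(** Both [tau] and [theta \o tau] send [y] to the image of the set of its lifts, so
    [coordinates_quotient] applies to each. *)
Lemma quotient_model_coordinates (A : comNzRingType) (rho : Defs.cover A) :
  model_coordinates (quotient_model G rho).
Proof.
have := torsion_free_model_coordinates (@cover_torsion_free _ rho).
set M := torsion_free_model _ _ => -[tauP thetaP].
have fS := @cover_surj _ rho.
have kerE : Delta_ker (rho := rho) = ker_image (cover_map rho) (tau M) by [].
have kerE' : AP_ker (rho := rho) = ker_image (cover_map rho) (@theta _ _ M \o tau M).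
  by rewrite /AP_ker /Delta_ker image_comp.
have tauE : tau (quotient_model G rho) = fun y => tau M @` lifts (cover_map rho) y.
  apply/funext => y; apply/seteqP; split=> z /=.
    move=> [b [/= by_ ]]; rewrite kerE (coset_ofE _ tauP).
    by rewrite (_ : comp_classmap _ b = y) //; apply: classmap_eq.
  move=> [b by_ <-]; exists b; split=> //; rewrite kerE (coset_ofE _ tauP).
  by exists b.
have thetaE : @theta _ _ (quotient_model G rho) \o tau (quotient_model G rho)
    = fun y => (@theta _ _ M \o tau M) @` lifts (cover_map rho) y.
  rewrite tauE; apply/funext => y; apply/seteqP; split=> z /=.
    move=> [_ [b by_ <-]]; rewrite kerE' (coset_ofE _ thetaP).
    by rewrite (_ : comp_classmap _ b = y) //; apply: classmap_eq.
  move=> [b by_ <-]; exists (tau M b); first by exists b.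
  by rewrite kerE' (coset_ofE _ thetaP); exists b.
split.
  by rewrite tauE /quotient_model /= kerE; exact: (coordinates_quotient fS tauP).
by rewrite thetaE /quotient_model /= kerE'; exact: (coordinates_quotient fS thetaP).
Qed.

Lemma the_model_coordinates (rho : cover_choice) (A : comNzRingType) :
  model_coordinates (the_model G rho A).
Proof.
rewrite /the_model; case: pselect => h.
  exact: torsion_free_model_coordinates.
exact: quotient_model_coordinates.
Qed.

(** * Naturality, and the equivalence of [AP_G], [Delta_G] and [W_G] *)

Lemma functor_coordinates_Delta (rho : cover_choice) :
  functor_coordinates (F := Delta_functor G rho) (fun A => tau (the_model G rho A)).
Proof.
split=> [A|A B f a]; first by have [] := the_model_coordinates rho A.
by apply: transportE; have [[]] := the_model_coordinates rho A.
Qed.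

Lemma functor_coordinates_AP (rho : cover_choice) :
  functor_coordinates (F := AP_functor G rho)
    (fun A => @theta _ _ (the_model G rho A) \o tau (the_model G rho A)).
Proof.
split=> [A|A B f a]; first by have [] := the_model_coordinates rho A.
by apply: transportE; have [_ []] := the_model_coordinates rho A.
Qed.

End Coordinates.

Theorem theorem4p16 (G : profiniteGroupType) (rho : cover_choice)
    (W : wittBurnside G) :
  [/\ is_functor (Delta_functor G rho),
      is_functor (AP_functor G rho),
      naturally_isomorphic (AP_functor G rho) (Delta_functor G rho)
    & naturally_isomorphic (AP_functor G rho) W].
Proof.
have DeltaP := functor_coordinates_Delta W rho.
have APP := functor_coordinates_AP W rho.
split.
- exact: functor_coordinates_functor DeltaP.
- exact: functor_coordinates_functor APP.
- exact: functor_coordinates_iso APP DeltaP.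
- exact: functor_coordinates_iso APP (functor_coordinates_W W).
Qed.
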